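(* Let $A=(a_{i,j})_{i,j=1}^n$ be a primitive $0$-$1$ matrix. Let $\{\sigma_i:i\in\Lambda\}$, $\Lambda=\{1,\ldots,n\}$, be a saturated semibranching function system with coding map $\sigma$ on a probability measure space $(X,m)$ satisfying condition (C-K) with associated matrix $A$, let $(m,(f_i)_{i\in\Lambda})$ be a monic system for it, and let $\pi$ be the representation of $\mathcal O_A$ on $L^2(X,m)$ generated by $$T_if=f_i\cdot (f\circ\sigma),\qquad f\in L^2(X,m),\ i\in\Lambda .$$ Then $\pi$ is a monic representation if and only if it is unitarily equivalent to a representation associated to an inherent monic system on $X_A$.
   Context: Semibranching function system (s.f.s.). Let $(X,m)$ be a probability space with $m$ non-atomic. A finite family $\{\sigma_i:i\in\Lambda\}$ of one-to-one measurable maps $\sigma_i:D_i\to R_i=\sigma_i(D_i)$, $D_i\subset X$, is an s.f.s. if: (i) $m(R_i\cap R_j)=0$ for $i\ne j$ and $m(X\setminus\bigcup_iR_i)=0$; (ii) $m\circ\sigma_i\ll m$ on $D_i$ (where $(m\circ\sigma_i)(C)=m(\sigma_i(C))$) and $\frac{d\,m\circ\sigma_i}{dm}>0$ a.e. on $D_i$; (iii) there is a measurable $\sigma:X\to X$ (coding map) with $\sigma\circ\sigma_i(x)=x$ for a.e. $x\in D_i$. It is saturated if $\bigcup_iD_i=X$ a.e. Condition (C-K): for each $i$ there is $\Lambda_i\subset\Lambda$ with $D_i=\bigcup_{j\in\Lambda_i}R_j$ a.e.; the associated matrix is $a_{i,j}=1\iff j\in\Lambda_i$. Monic system. For an s.f.s.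 $\{\sigma_i:D_i\to R_i\}_{i\in\Lambda}$ with coding map $\sigma$ on a probability space $(X,m)$, $(m,(f_i)_{i\in\Lambda})$ is a monic system if for every $i$ one has $m\circ\sigma_i^{-1}\ll m$ and $\frac{d\,m\circ\sigma_i^{-1}}{dm}=|f_i|^2$ for some $f_i\in L^2(X,m)$ with $f_i\ne0$ for $m$-a.e. $x\in R_i$; here $(m\circ\sigma_i^{-1})(C)=m(\sigma_i^{-1}(C\cap R_i))$, so $f_i=0$ a.e. off $R_i$. The representation of $\mathcal O_A$ generated by $T_if=f_i\cdot(f\circ\sigma)$ is called associated to the monic system. Inherent monic system. $X_A=\{x=(x_k)_{k\ge1}:x_k\in\{1,\ldots,n\},\ a_{x_k,x_{k+1}}=1\}$ is the topological Markov chain (with its product topology); $D_i=\{x\in X_A:a_{i,x_1}=1\}$, $R_i=\{x\in X_A:x_1=i\}$, $\sigma_i:D_i\to R_i$, $\sigma_i(x)=ix$ (concatenation), and $\sigma(x_1,x_2,\ldots)=(x_2,x_3,\ldots)$. A monic system $(\mu,(f_i))$ on $X_A$ for this s.f.s. (with $\mu$ a Borel probability measure making it an s.f.s.) is called inherent. Cuntz-Krieger algebra. $\mathcal O_A$ is the $C^*$-algebra generated by partial isometries $S_1,\ldots,S_n$ with $\sum_iS_iS_i^*=1$, $S_i^*S_i=\sum_ja_{i,j}S_jS_j^*$. For a finite word $I=i_1\cdots i_k$ put $S_I=S_{i_1}\cdots S_{i_k}$; $\mathcal D_A$ is the abelian $C^*$-subalgebra generated by all $S_IS_I^*$. Monic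 representation. A representation $\pi$ of $\mathcal O_A$ on $\mathcal H$ is monic if $\mathcal D_A$ has a cyclic vector, i.e. there is $\xi\in\mathcal H$ with $\overline{\mathrm{span}}\{T_IT_I^*\xi: I\text{ a finite word}\}=\mathcal H$, where $T_I=\pi(S_I)$. *)

(* Defs.v *)
From HB Require Import structures.
From mathcomp Require Import all_boot all_order all_algebra.
From mathcomp Require Import all_classical all_reals all_analysis.
From mathcomp Require Import measurable_realfun complex.

Set Implicit Arguments.
Unset Strict Implicit.
Unset Printing Implicit Defensive.

Import Order.TTheory GRing.Theory Num.Theory.
Import Normc.

Local Open Scope classical_set_scope.
Local Open Scope ring_scope.
Local Open Scope complex_scope.
Local Open Scope quotient_scope.

(** * Complex inner product spaces *)

Record innerProductSpace (R : realType) := InnerProductSpace {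
  ip_car :> lmodType R[i];
  inner : ip_car -> ip_car -> R[i];
  innerP : forall (c : R[i]) (u v w : ip_car),
    inner (c *: u + v) w = c * inner u w + inner v w;
  inner_conj : forall u v : ip_car, inner v u = conjc (inner u v);
  inner_ge0 : forall u : ip_car, 0 <= inner u u;
  inner_eq0 : forall u : ip_car, inner u u = 0 -> u = 0
}.

Definition ipnorm (R : realType) (H : innerProductSpace R) (u : H) : R :=
  Num.sqrt (complex.Re (inner u u)).

(** * The Hilbert space L^2 of complex-valued functions *)

Lemma complexRe_mul (R : realType) (a b : R[i]) :
  complex.Re (a * b) =
  complex.Re a * complex.Re b - complex.Im a * complex.Im b.
Proof. by case: a b => a a' [b b']. Qed.

Lemma complexIm_mul (R : realType) (a b : R[i]) :
  complex.Im (a * b) =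
  complex.Re a * complex.Im b + complex.Im a * complex.Re b.
Proof. by case: a b => a a' [b b']. Qed.

Lemma complexRe_add (R : realType) (a b : R[i]) :
  complex.Re (a + b) = complex.Re a + complex.Re b.
Proof. by case: a b => a a' [b b']. Qed.

Lemma complexIm_add (R : realType) (a b : R[i]) :
  complex.Im (a + b) = complex.Im a + complex.Im b.
Proof. by case: a b => a a' [b b']. Qed.

Section ComplexL2.
Context d (T : measurableType d) (R : realType).
Variable mu : {measure set T -> \bar R}.

Definition CLfun2 : {pred T -> R[i]} :=
  [pred f | ((fun x => complex.Re (f x)) \in Lfun mu 2%:E) &&
            ((fun x => complex.Im (f x)) \in Lfun mu 2%:E)].

Let le12 : (1 <= 2%:E :> \bar R)%E. Proof. by rewrite lee_fin ler1n. Qed.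

Let L20 : (0 : T -> R) \in Lfun mu 2%:E.
Proof. by have [] := Lfun_submod_closed mu le12. Qed.

Let L2L a (f g : T -> R) : f \in Lfun mu 2%:E -> g \in Lfun mu 2%:E ->
  a *: f + g \in Lfun mu 2%:E.
Proof. by have [_] := Lfun_submod_closed mu le12; apply. Qed.

Lemma CLfun2_submod_closed : submod_closed CLfun2.
Proof.
split.
  by rewrite inE; apply/andP; split; exact: L20.
move=> c f g; rewrite !inE => /andP[rf jf] /andP[rg jg].
set rf' := fun x => _ in rf; set jf' := fun x => _ in jf.
set rg' := fun x => _ in rg; set jg' := fun x => _ in jg.
apply/andP; split.
- have -> : (fun x => complex.Re ((c *: f + g) x)) =
    complex.Re c *: rf' + ((- complex.Im c) *: jf' + rg').
    apply/funext => x; rewrite !fctE complexRe_add complexRe_mul addrA.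
    by rewrite -[(- _) *: _]/(- _ * _) mulNr.
  by apply: L2L => //; apply: L2L.
- have -> : (fun x => complex.Im ((c *: f + g) x)) =
    complex.Re c *: jf' + (complex.Im c *: rf' + jg').
    by apply/funext => x; rewrite !fctE complexIm_add complexIm_mul addrA.
  by apply: L2L => //; apply: L2L.
Qed.

HB.instance Definition _ := GRing.isSubmodClosed.Build _ _ CLfun2
  CLfun2_submod_closed.

Record L2fun := MkL2fun { l2val :> T -> R[i]; l2valP : l2val \in CLfun2 }.
HB.instance Definition _ := [isSub for l2val].
HB.instance Definition _ := [Choice of L2fun by <:].
HB.instance Definition _ := [SubChoice_isSubLmodule of L2fun by <:].

Definition L2null : {pred L2fun} :=
  [pred f : L2fun | `[< {ae mu, forall x, f x = 0} >]].

Lemma L2null_zmod_closed : zmod_closed L2null.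
Proof.
split.
  by apply/asboolP; exact: aeW.
move=> f g /asboolP f0 /asboolP g0; apply/asboolP.
by apply: filterS2 f0 g0 => x /= fx gx; rewrite !fctE fx gx subrr.
Qed.

HB.instance Definition _ := GRing.isZmodClosed.Build _ L2null L2null_zmod_closed.

Definition L2 : Type := Quotient.quot L2null.
HB.instance Definition _ := GRing.Zmodule.on L2.
HB.instance Definition _ := EqQuotient.on L2.

(* Applying an element of L^2 to a point goes through a representative chosen
   by repr, so it is meaningful only up to a null set. *)
Definition L2_to_fun (u : L2) : T -> R[i] := repr u.
Coercion L2_to_fun : L2 >-> Funclass.

Definition L2class : L2fun -> L2 := \pi_L2.

Lemma L2_eqP (u v : L2) : u = v <-> {ae mu, forall x, u x = v x}.
Proof.
split=> [->|uv]; first exact: aeW.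
rewrite -[u]reprK -[v]reprK; apply/eqP.
rewrite -Quotient.idealrBE; apply/asboolP.
by apply: filterS uv => x /= uvx; rewrite !fctE; apply/eqP; rewrite subr_eq0; apply/eqP.
Qed.

Lemma L2class_ae (f : L2fun) : {ae mu, forall x, L2class f x = f x}.
Proof.
have /eqP : repr (L2class f) = f %[mod L2] by rewrite reprK.
rewrite -Quotient.idealrBE => /asboolP; apply: filterS => x /=.
by rewrite !fctE => /eqP; rewrite subr_eq0 => /eqP.
Qed.

Definition L2scale (c : R[i]) (u : L2) : L2 := L2class (c *: repr u).

Lemma L2scale_ae c (u : L2) : {ae mu, forall x, L2scale c u x = c * u x}.
Proof. by apply: filterS (L2class_ae (c *: repr u)). Qed.

Lemma L2add_ae (u v : L2) : {ae mu, forall x, (u + v : L2) x = u x + v x}.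
Proof.
have -> : u + v = L2class (repr u + repr v).
  by rewrite /L2class -[u in LHS]reprK -[v in LHS]reprK !piE.
by apply: filterS (L2class_ae (repr u + repr v)).
Qed.

Let scaleA a b u : L2scale a (L2scale b u) = L2scale (a * b) u.
Proof.
apply/L2_eqP.
have h1 := L2scale_ae a (L2scale b u); have h2 := L2scale_ae b u.
have h3 := L2scale_ae (a * b) u.
by apply: filterS (filterI h1 (filterI h2 h3)) => x /= [-> [-> ->]]; rewrite mulrA.
Qed.

Let scale1 : left_id 1 L2scale.
Proof.
by move=> u; apply/L2_eqP; apply: filterS (L2scale_ae 1 u) => x ->; rewrite mul1r.
Qed.

Let scaleDr : right_distributive L2scale +%R.
Proof.
move=> c u v; apply/L2_eqP.
have h1 := L2scale_ae c (u + v); have h2 := L2add_ae u v.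
have h3 := L2add_ae (L2scale c u) (L2scale c v).
have h4 := L2scale_ae c u; have h5 := L2scale_ae c v.
by apply: filterS (filterI h1 (filterI h2 (filterI h3 (filterI h4 h5)))) => x /= [-> [-> [-> [-> ->]]]]; rewrite mulrDr.
Qed.

Let scaleDl u : {morph L2scale^~ u : a b / a + b}.
Proof.
move=> a b; apply/L2_eqP.
have h1 := L2scale_ae (a + b) u.
have h3 := L2add_ae (L2scale a u) (L2scale b u).
have h4 := L2scale_ae a u; have h5 := L2scale_ae b u.
by apply: filterS (filterI h1 (filterI h3 (filterI h4 h5))) => x /= [-> [-> [-> ->]]]; rewrite mulrDl.
Qed.

HB.instance Definition _ := GRing.Zmodule_isLmodule.Build R[i] L2
  scaleA scale1 scaleDr scaleDl.

Definition Cintegral (f : T -> R[i]) : R[i] :=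
  (\int[mu]_x complex.Re (f x)) +i* (\int[mu]_x complex.Im (f x)).

Definition Cintegrable (f : T -> R[i]) : Prop :=
  mu.-integrable setT (EFin \o (fun x => complex.Re (f x))) /\
  mu.-integrable setT (EFin \o (fun x => complex.Im (f x))).

Definition L2inner (u v : L2) : R[i] :=
  Cintegral (fun x => u x * conjc (v x)).

Lemma Cintegrable_ip (u v : L2) : Cintegrable (fun x => u x * conjc (v x)).
Proof.
have /andP[ru iu] : (u : T -> R[i]) \in CLfun2 by exact: l2valP.
have /andP[rv iv] : (v : T -> R[i]) \in CLfun2 by exact: l2valP.
have H (f g : T -> R) : f \in Lfun mu 2%:E -> g \in Lfun mu 2%:E ->
    mu.-integrable setT (EFin \o (f \* g)).
  by move=> hf hg; apply/Lfun1_integrable; exact: Lfun2_mul_Lfun1.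
split.
- have := integrableD measurableT (H _ _ ru rv) (H _ _ iu iv).
  apply: eq_integrable => // x _ /=; congr EFin.
  by case: (u x) (v x) => a b [e g] /=; rewrite mulrN opprK.
- have := integrableB measurableT (H _ _ iu rv) (H _ _ ru iv).
  apply: eq_integrable => // x _ /=; congr EFin.
  by case: (u x) (v x) => a b [e g] /=; rewrite mulrN addrC.
Qed.

Lemma Cintegral_ae (f g : T -> R[i]) : Cintegrable f -> Cintegrable g ->
  {ae mu, forall x, f x = g x} -> Cintegral f = Cintegral g.
Proof.
move=> [rf jf] [rg jg] fg; rewrite /Cintegral /Rintegral.
have mE h : mu.-integrable setT h -> measurable_fun setT h by case/integrableP.
congr (fine _ +i* fine _); apply: ae_eq_integral => //; do ?exact: mE.
- by apply: filterS fg => x /= ->.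
- by apply: filterS fg => x /= ->.
Qed.

Let intL (a b : R) (f g : T -> R) :
  mu.-integrable setT (EFin \o f) -> mu.-integrable setT (EFin \o g) ->
  mu.-integrable setT (EFin \o (fun x => a * f x + b * g x)) /\
  \int[mu]_x (a * f x + b * g x) = a * \int[mu]_x f x + b * \int[mu]_x g x.
Proof.
move=> If Ig.
have Iaf : mu.-integrable setT (EFin \o (fun x => a * f x)).
  by apply: eq_integrable (integrableZl measurableT a If).
have Ibg : mu.-integrable setT (EFin \o (fun x => b * g x)).
  by apply: eq_integrable (integrableZl measurableT b Ig).
split; last by rewrite RintegralD// !RintegralZl.
by apply: eq_integrable (integrableD measurableT Iaf Ibg).
Qed.

Lemma CintegralP (c : R[i]) (f g : T -> R[i]) :
  Cintegrable f -> Cintegrable g ->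
  Cintegrable (fun x => c * f x + g x) /\
  Cintegral (fun x => c * f x + g x) = c * Cintegral f + Cintegral g.
Proof.
move=> [rf jf] [rg jg].
have [I1 E1] := intL (complex.Re c) (- complex.Im c) rf jf.
have [I2 E2] := intL 1 1 I1 rg.
have [I3 E3] := intL (complex.Re c) (complex.Im c) jf rf.
have [I4 E4] := intL 1 1 I3 jg.
have ER x : complex.Re (c * f x + g x) = 1 * (complex.Re c * complex.Re (f x) +
    - complex.Im c * complex.Im (f x)) + 1 * complex.Re (g x).
  by rewrite complexRe_add complexRe_mul !mul1r mulNr.
have EI x : complex.Im (c * f x + g x) = 1 * (complex.Re c * complex.Im (f x) +
    complex.Im c * complex.Re (f x)) + 1 * complex.Im (g x).
  by rewrite complexIm_add complexIm_mul !mul1r.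
split.
  split.
    by apply: eq_integrable I2 => // x _ /=; rewrite ER.
  by apply: eq_integrable I4 => // x _ /=; rewrite EI.
rewrite {1}/Cintegral.
under eq_Rintegral do rewrite ER.
under [X in _ +i* X]eq_Rintegral do rewrite EI.
rewrite E2 E1 E4 E3 /Cintegral !mul1r; case: c {I1 E1 I2 E2 I3 E3 I4 E4 ER EI} => a b /=.
by simpc.
Qed.

Lemma L2innerP (c : R[i]) (u v w : L2) :
  L2inner (c *: u + v) w = c * L2inner u w + L2inner v w.
Proof.
have [I <-] := CintegralP c (Cintegrable_ip u w) (Cintegrable_ip v w).
apply: Cintegral_ae => //; first exact: Cintegrable_ip.
have h1 := L2add_ae (c *: u) v; have h2 := L2scale_ae c u.
by apply: filterS (filterI h1 h2) => x /= [-> ->]; rewrite mulrDl mulrA.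
Qed.

Lemma L2inner_conj (u v : L2) : L2inner v u = conjc (L2inner u v).
Proof.
have [_ I] := Cintegrable_ip u v.
rewrite /L2inner /Cintegral /= -mulN1r -RintegralZl//; congr (_ +i* _).
- by apply: eq_Rintegral => x _; case: (u x) (v x) => a b [e g] /=;
    rewrite !mulrN !opprK [e * a]mulrC [g * b]mulrC.
- by apply: eq_Rintegral => x _; case: (u x) (v x) => a b [e g] /=;
    rewrite mulN1r !mulrN opprD opprK addrC [g * a]mulrC [e * b]mulrC addrC.
Qed.

Let inner_self (u : L2) : L2inner u u =
  (\int[mu]_x (complex.Re (u x) ^+ 2 + complex.Im (u x) ^+ 2))%:C.
Proof.
rewrite /L2inner /Cintegral; congr (_ +i* _).
  by apply: eq_Rintegral => x _; case: (u x) => a b /=; rewrite mulrN opprK !expr2.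
rewrite (_ : Rintegral _ _ _ = \int[mu]_x (cst 0 x)); last first.
  by apply: eq_Rintegral => x _; case: (u x) => a b /=; rewrite mulrN mulrC addNr.
by rewrite /Rintegral integral0.
Qed.

Lemma L2inner_ge0 (u : L2) : 0 <= L2inner u u.
Proof.
rewrite inner_self lecE /= eqxx /=.
by apply: Rintegral_ge0 => // x _; rewrite addr_ge0 ?sqr_ge0.
Qed.

Lemma L2inner_eq0 (u : L2) : L2inner u u = 0 -> u = 0.
Proof.
have [I _] := Cintegrable_ip u u.
have {}I : mu.-integrable setT
    (EFin \o (fun x => complex.Re (u x) ^+ 2 + complex.Im (u x) ^+ 2)).
  apply: eq_integrable I => // x _ /=.
  by case: (u x) => a b /=; rewrite mulrN opprK !expr2.
rewrite inner_self => -[] /eqP.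
rewrite /Rintegral fine_eq0 ?integrable_fin_num// => /eqP h.
have /integrableP[mI _] := I.
have /(ae_eq_integral_abs mu measurableT mI).1 H : (\int[mu]_x `|(EFin \o
    (fun x => (complex.Re (u x) ^+ 2 + complex.Im (u x) ^+ 2)%R)) x| = 0)%E.
  rewrite -[RHS]h; apply: eq_integral => x _ /=.
  by rewrite ger0_norm// addr_ge0 ?sqr_ge0.
apply/L2_eqP; have h0 : {ae mu, forall x, L2scale 0 0 x = 0 * (0 : L2) x}.
  exact: L2scale_ae.
have <- : L2scale 0 0 = 0 by exact: (scaler0 L2).
apply: filterS (filterI H h0) => x /= [/(_ Logic.I) [] /eqP + ->]; rewrite mul0r.
case: (u x) => a b /=; rewrite paddr_eq0 ?sqr_ge0// !sqrf_eq0.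
by move=> /andP[/eqP -> /eqP ->].
Qed.

Definition L2space : innerProductSpace R :=
  InnerProductSpace L2innerP L2inner_conj L2inner_ge0 L2inner_eq0.

End ComplexL2.

(** * C*-algebras and Cuntz-Krieger algebras *)

Record cstarAlgebra (R : realType) := CstarAlgebra {
  cs_car :> algType R[i];
  star : cs_car -> cs_car;
  cnorm : cs_car -> R;
  starK : forall a : cs_car, star (star a) = a;
  starP : forall (c : R[i]) (a b : cs_car),
    star (c *: a + b) = conjc c *: star a + star b;
  starM : forall a b : cs_car, star (a * b) = star b * star a;
  cnorm_eq0 : forall a : cs_car, cnorm a = 0 -> a = 0;
  cnormD : forall a b : cs_car, cnorm (a + b) <= cnorm a + cnorm b;
  cnormZ : forall (c : R[i]) (a : cs_car), cnorm (c *: a) = normc c * cnorm a;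
  cnormM : forall a b : cs_car, cnorm (a * b) <= cnorm a * cnorm b;
  cnorm_star : forall a : cs_car, cnorm (star a * a) = cnorm a ^+ 2;
  cnorm_complete : forall u : nat -> cs_car,
    (forall e : R, 0 < e -> exists N : nat, forall p q : nat,
       (N <= p)%N -> (N <= q)%N -> cnorm (u p - u q) < e) ->
    exists l : cs_car, forall e : R, 0 < e -> exists N : nat, forall p : nat,
       (N <= p)%N -> cnorm (u p - l) < e
}.

Definition star_morphism (R : realType) (A B : cstarAlgebra R) (phi : A -> B) :
    Prop :=
  [/\ linear phi, phi 1 = 1, {morph phi : a b / a * b}
    & {morph phi : a / star a >-> star a}].

Definition closed_star_subalgebra (R : realType) (A : cstarAlgebra R)
    (P : set A) : Prop :=
  [/\ P 1,
      forall (c : R[i]) (a b : A), P a -> P b -> P (c *: a + b),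
      forall a b : A, P a -> P b -> P (a * b),
      forall a : A, P a -> P (star a)
    & forall a : A, (forall e : R, 0 < e -> exists2 b : A, P b & cnorm (a - b) < e) ->
        P a].

Definition generated_by (R : realType) (A : cstarAlgebra R) (I : Type)
    (S : I -> A) : Prop :=
  forall P : set A, closed_star_subalgebra P -> (forall i, P (S i)) -> P = setT.

(* 0-1 matrices have natural number entries, so that [x *+ A i j] is the term
   a_{i,j} x of a sum. *)
Definition primitive01 (n : nat) (A : 'M[nat]_n.+1) : Prop :=
  (forall i j, (A i j <= 1)%N) /\
  (exists2 k : nat, (0 < k)%N & forall i j, (0 < (A ^+ k) i j)%N).

Definition cuntz_krieger_family (R : realType) (n : nat) (A : 'M[nat]_n.+1)
    (O : cstarAlgebra R) (S : 'I_n.+1 -> O) : Prop :=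
  [/\ forall i, S i * star (S i) * S i = S i,
      \sum_i S i * star (S i) = 1
    & forall i, star (S i) * S i = \sum_j (S j * star (S j)) *+ A i j].

(* O, with its generators S, is the universal C*-algebra of the Cuntz-Krieger
   relations; this determines (O, S) up to a unique *-isomorphism. *)
Definition is_cuntz_krieger_algebra (R : realType) (n : nat)
    (A : 'M[nat]_n.+1) (O : cstarAlgebra R) (S : 'I_n.+1 -> O) : Prop :=
  [/\ cuntz_krieger_family A S, generated_by S
    & forall (B : cstarAlgebra R) (T : 'I_n.+1 -> B),
        cuntz_krieger_family A T ->
        exists2 phi : O -> B, star_morphism phi & forall i, phi (S i) = T i].

(** * Representations *)

(* Stated for inner product spaces, as completeness plays no role in the
   definitions below; they are only used for L^2 spaces. *)
Definition is_representation (R : realType) (O : cstarAlgebra R)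
    (H : innerProductSpace R) (pi : O -> H -> H) : Prop :=
  [/\ forall a, linear (pi a) /\
        exists M : R, forall v, ipnorm (pi a v) <= M * ipnorm v,
      forall (c : R[i]) a b v, pi (c *: a + b) v = c *: pi a v + pi b v,
      forall v, pi 1 v = v,
      forall a b v, pi (a * b) v = pi a (pi b v)
    & forall a v w, inner (pi a v) w = inner v (pi (star a) w)].

Definition word_prod (R : realType) (n : nat) (O : cstarAlgebra R)
    (S : 'I_n.+1 -> O) (I : seq 'I_n.+1) : O :=
  \prod_(i <- I) S i.

Definition monic_representation (R : realType) (n : nat) (O : cstarAlgebra R)
    (S : 'I_n.+1 -> O) (H : innerProductSpace R) (pi : O -> H -> H) : Prop :=
  exists xi : H, forall (v : H) (e : R), 0 < e ->
    exists (N : nat) (c : 'I_N -> R[i]) (I : 'I_N -> seq 'I_n.+1),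
      ipnorm (v - \sum_(k < N)
        c k *: pi (word_prod S (I k) * star (word_prod S (I k))) xi) < e.

Definition unitarily_equivalent (R : realType) (O : cstarAlgebra R)
    (H K : innerProductSpace R) (pi : O -> H -> H) (rho : O -> K -> K) : Prop :=
  exists U : H -> K,
    [/\ linear U,
        forall v w, inner (U v) (U w) = inner v w,
        forall w, exists v, U v = w
      & forall a v, U (pi a v) = rho a (U v)].

(** * Semibranching function systems and monic systems *)

Section SFS.
Context d (X : measurableType d) (R : realType).
Variable m : probability X R.

Definition nonatomic : Prop :=
  forall B, measurable B -> (0 < m B)%E ->
    exists C, [/\ measurable C, C `<=` B, (0 < m C)%E & (m C < m B)%E].

Definition is_RN_derivative (nu : set X -> \bar R) (h : X -> \bar R) : Prop :=
  [/\ measurable_fun setT h, (forall x, 0 <= h x)%E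
    & forall C, measurable C -> nu C = (\int[m]_(x in C) h x)%E].

Section Maps.
Variables (Lambda : finType) (D : Lambda -> set X) (s : Lambda -> X -> X).

(* Only the values of [s i] on [D i] are relevant. *)
Definition sfs_range (i : Lambda) : set X := s i @` D i.

(* m o sigma_i and m o sigma_i^{-1}, as set functions on X. *)
Definition sfs_push (i : Lambda) : set X -> \bar R :=
  fun C => m (s i @` (C `&` D i)).
Definition sfs_pull (i : Lambda) : set X -> \bar R :=
  fun C => m (D i `&` s i @^-1` (C `&` sfs_range i)).

Record is_sfs (sigma : X -> X) : Prop := IsSfs {
  sfs_nonatomic : nonatomic;
  sfs_measurable_dom : forall i, measurable (D i);
  sfs_measurable_fun : forall i, measurable_fun (D i) (s i);
  sfs_inj : forall i, set_inj (D i) (s i);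
  (* Needed for m o sigma_i to make sense; automatic on standard Borel
     spaces. *)
  sfs_measurable_image : forall i C, measurable C -> C `<=` D i ->
    measurable (s i @` C);
  sfs_disjoint : forall i j, i != j -> m (sfs_range i `&` sfs_range j) = 0%E;
  sfs_cover : m (~` \bigcup_(i in [set: Lambda]) sfs_range i) = 0%E;
  sfs_dominated : forall i, sfs_push i `<< m;
  sfs_derivative : forall i, exists2 h, is_RN_derivative (sfs_push i) h &
    {ae m, forall x, D i x -> (0 < h x)%E};
  sfs_measurable_coding : measurable_fun setT sigma;
  sfs_coding : forall i, {ae m, forall x, D i x -> sigma (s i x) = x}
}.

Definition sfs_saturated : Prop :=
  m (~` \bigcup_(i in [set: Lambda]) D i) = 0%E.

Definition is_monic_system (sigma : X -> X) (f : Lambda -> L2 m) : Prop :=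
  [/\ is_sfs sigma,
      forall i, sfs_pull i `<< m,
      forall i, is_RN_derivative (sfs_pull i)
        (fun x => (normc (f i x) ^+ 2)%:E)
    & forall i, {ae m, forall x, sfs_range i x -> f i x != 0}].

End Maps.

Definition sfs_cuntz_krieger (n : nat) (A : 'M[nat]_n.+1)
    (D : 'I_n.+1 -> set X) (s : 'I_n.+1 -> X -> X) : Prop :=
  forall i, {ae m, forall x,
    D i x <-> (\bigcup_(j in [set j | A i j = 1%N]) sfs_range D s j) x}.

(* pi is the representation with pi (S_i) f = f_i . (f o sigma). *)
Definition representation_of_monic_system (n : nat) (O : cstarAlgebra R)
    (S : 'I_n.+1 -> O) (sigma : X -> X) (f : 'I_n.+1 -> L2 m)
    (pi : O -> L2space m -> L2space m) : Prop :=
  is_representation pi /\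
  forall (i : 'I_n.+1) (u : L2 m),
    {ae m, forall x, (pi (S i) u : L2 m) x = f i x * u (sigma x)}.

End SFS.

(** * The topological Markov chain *)

Section MarkovChain.
Variables (n : nat) (A : 'M[nat]_n.+1).

Definition admissible (x : nat -> 'I_n.+1) : Prop :=
  forall k, A (x k) (x k.+1) = 1%N.

Definition markovChain (HA : primitive01 A) : Type :=
  {x : nat -> 'I_n.+1 | admissible x}.

Variable HA : primitive01 A.
Local Notation XA := (markovChain HA).

Lemma primitive01_next (i : 'I_n.+1) : exists j, A i j == 1%N.
Proof.
have [A01 [[//|k] _ Ak]] := HA.
apply/not_existsP => h; have := Ak i i.
rewrite exprS mxE big1 // => j _.
have := A01 i j; case: (A i j) (h j) => [|[|]]// _ _; exact: mul0r.
Qed.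

Definition admissible_next (i : 'I_n.+1) : 'I_n.+1 := xchoose (primitive01_next i).

Lemma admissible_iter : admissible (fun k => iter k admissible_next ord0).
Proof. by move=> k; apply/eqP; exact: (xchooseP (primitive01_next _)). Qed.

HB.instance Definition _ := gen_eqMixin XA.
HB.instance Definition _ := gen_choiceMixin XA.
HB.instance Definition _ := isPointed.Build XA (exist _ _ admissible_iter).

(* Subspace of the product of copies of the discrete space 'I_n.+1. *)
Definition markovChainTop : Type :=
  initial_topology
    (fun x : XA => (sval x : {ptws nat -> discrete_topology 'I_n.+1})).
HB.instance Definition _ := Topological.on markovChainTop.
HB.instance Definition _ := Pointed.on markovChainTop.

Definition markovChainBorel := g_sigma_algebraType (@open markovChainTop).
HB.instance Definition _ := Measurable.on markovChainBorel.

(* Sequences are indexed from 0. *)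
Definition mc_dom (i : 'I_n.+1) : set markovChainBorel :=
  [set x | A i (sval x 0%N) = 1%N].

Definition mc_cons_seq (i : 'I_n.+1) (x : nat -> 'I_n.+1) : nat -> 'I_n.+1 :=
  fun k => if k is k'.+1 then x k' else i.

(* Concatenation x |-> ix; the value off [mc_dom i] is irrelevant. *)
Definition mc_cons (i : 'I_n.+1) (x : markovChainBorel) : markovChainBorel :=
  match pselect (admissible (mc_cons_seq i (sval x))) with
  | left h => exist admissible _ h
  | right _ => x
  end.

Definition mc_shift (x : markovChainBorel) : markovChainBorel :=
  exist admissible (fun k => sval x k.+1) (fun k => svalP x k.+1).

Definition inherent_monic_system (R : realType)
    (mu : probability markovChainBorel R) (g : 'I_n.+1 -> L2 mu) : Prop :=
  is_monic_system mc_dom mc_cons mc_shift g.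

End MarkovChain.

(* Main.v *)
Require Import Defs.
From HB Require Import structures.
From mathcomp Require Import all_boot all_order all_algebra.
From mathcomp Require Import all_classical all_reals all_analysis.
From mathcomp Require Import measurable_realfun complex.
From mathcomp Require Import ring lra.

(* The itinerary map F : X -> X_A records the ranges R_i visited by the orbit of
   x under sigma; it intertwines sigma with the shift almost everywhere.  The
   Cuntz-Krieger relations force pi(S_I S_I^* ) to be multiplication by the
   indicator of the set of points whose itinerary starts with I.  If xi is
   cyclic for D_A, every v in L^2(m) is thus an L^2-limit, hence along a fast
   sequence an a.e. limit, of functions (phi_k o F) xi with phi_k simple; so
   v / xi factors through F, and (taking v = 1) so does v.  Therefore h |-> h o F
   is a unitary from L^2(F_* m) onto L^2(m), and it transports the monic system
   and the representation to X_A.  Conversely, on X_A the constant 1 is cyclic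
   because cylinders form a pi-system generating the Borel sets. *)

Set Implicit Arguments.
Unset Strict Implicit.
Unset Printing Implicit Defensive.

Import Order.TTheory GRing.Theory Num.Theory.
Import numFieldNormedType.Exports.

Local Open Scope classical_set_scope.
Local Open Scope ring_scope.

(** * Inner products and closed spans *)

(** [X] is an arbitrary measurable space, so F need not be injective off a null set. The
    factorization of every function of L^2(m) through F, up to null sets, takes the place of a point
    isomorphism. Besides making the pullback surjective, it keeps the image measure non-atomic,
    since indicators of subsets of [X] descend to X_A, and it carries the density of m o sigma_i
    down to X_A. All relations between F, sigma and the branches hold only almost everywhere. They
    survive composition with sigma because m o sigma_i << m, and composition with sigma_i because m
    o sigma_i^{-1} << m. Division by xi is legitimate because a cyclic xi cannot vanish on a set of
    positive measure: every approximant of the constant 1 would vanish there. *)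

Section SquaredModulus.
Variable R : realType.
Implicit Types z w : R[i].

(** Working with |z|^2 instead of |z| keeps square roots out, so that identities are polynomial and
    the L^2 norm is a plain integral. *)
Definition sqmod (z : R[i]) : R := complex.Re z ^+ 2 + complex.Im z ^+ 2.

Lemma sqmod_ge0 z : 0 <= sqmod z.
Proof. by rewrite addr_ge0 ?sqr_ge0. Qed.

Lemma sqmod0 : sqmod 0 = 0.
Proof. by rewrite /sqmod /= expr0n addr0. Qed.

Lemma sqmod_eq0 z : sqmod z = 0 -> z = 0.
Proof.
case: z => a b /eqP; rewrite paddr_eq0 ?sqr_ge0// !sqrf_eq0 /=.
by move=> /andP[/eqP-> /eqP->].
Qed.

Lemma normc_sqr z : Normc.normc z ^+ 2 = sqmod z.
Proof. by case: z => a b; rewrite sqr_sqrtr// addr_ge0 ?sqr_ge0. Qed.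

Lemma sqmodM z w : sqmod (z * w) = sqmod z * sqmod w.
Proof. by case: z w => a b [e g]; rewrite /sqmod /=; ring. Qed.

Lemma mul_conjc z : z * conjc z = (sqmod z)%:C%C.
Proof. by case: z => a b; rewrite /sqmod; apply/eqP; rewrite eq_complex /=;
  apply/andP; split; apply/eqP; ring. Qed.

Lemma Re_sqr_le_sqmod z : complex.Re z ^+ 2 <= sqmod z.
Proof. by rewrite lerDl sqr_ge0. Qed.

Lemma Im_sqr_le_sqmod z : complex.Im z ^+ 2 <= sqmod z.
Proof. by rewrite lerDr sqr_ge0. Qed.

End SquaredModulus.

Section InnerProduct.
Context (R : realType) (H : innerProductSpace R).
Implicit Types (u v w : H) (c : R[i]).

Definition sqnorm u : R := complex.Re (inner u u).

Lemma innerDl u v w : inner (u + v) w = inner u w + inner v w.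
Proof. by have := innerP 1 u v w; rewrite scale1r mul1r. Qed.

Lemma inner0l w : inner 0 w = 0.
Proof. by apply: (@addrI _ (inner 0 w)); rewrite -innerDl !addr0. Qed.

Lemma innerZl c u w : inner (c *: u) w = c * inner u w.
Proof. by have := innerP c u 0 w; rewrite inner0l !addr0. Qed.

Lemma innerDr u v w : inner w (u + v) = inner w u + inner w v.
Proof. by rewrite !(inner_conj _ w) innerDl rmorphD. Qed.

Lemma innerZr c u w : inner w (c *: u) = conjc c * inner w u.
Proof. by rewrite !(inner_conj _ w) innerZl rmorphM. Qed.

Lemma inner_self u : inner u u = (sqnorm u)%:C%C.
Proof.
have := inner_ge0 u; rewrite /sqnorm; case: (inner u u) => a b.
by rewrite lecE /= => /andP[/eqP -> _].
Qed.

Lemma sqnorm_ge0 u : 0 <= sqnorm u.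
Proof. by have := inner_ge0 u; rewrite inner_self lecE /= => /andP[]. Qed.

Lemma sqnormZ c u : sqnorm (c *: u) = sqmod c * sqnorm u.
Proof.
rewrite {1}/sqnorm innerZl innerZr mulrA mul_conjc inner_self.
by rewrite -rmorphM.
Qed.

(** By the parallelogram law the two sides differ by the squared norm of u - v. This weak triangle
    inequality replaces Cauchy-Schwarz below. *)
Lemma sqnormD u v : sqnorm (u + v) <= 2 * sqnorm u + 2 * sqnorm v.
Proof.
have := sqnorm_ge0 (u - v); rewrite /sqnorm -scaleN1r.
have cN : conjc (-1 : R[i]) = -1 by rewrite rmorphN1.
rewrite !(innerDl, innerDr, innerZl, innerZr) cN !mulN1r opprK !complexRe_add.
by rewrite !raddfN /=; nra.
Qed.

Lemma ipnorm_lt u (e : R) : 0 < e -> (ipnorm u < e) = (sqnorm u < e ^+ 2).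
Proof.
move=> e0; rewrite -[in LHS](ger0_norm (ltW e0)) -sqrtr_sqr.
by rewrite ltr_sqrt// exprn_gt0.
Qed.

Definition closed_subspace (P : set H) : Prop :=
  [/\ P 0, forall c u v, P u -> P v -> P (c *: u + v)
    & forall v, (forall e : R, 0 < e -> exists2 u, P u & sqnorm (v - u) < e) -> P v].

(** Combinations are lists of coefficient-index pairs with repetitions allowed, so that adding two
    of them is concatenation. *)
Definition closed_span (W : Type) (b : W -> H) : set H :=
  [set v | forall e : R, 0 < e ->
    exists s : seq (R[i] * W), sqnorm (v - \sum_(p <- s) p.1 *: b p.2) < e].

Lemma closed_span_gen (W : Type) (b : W -> H) i : closed_span b (b i).
Proof.
move=> e e0; exists [:: (1, i)].
by rewrite big_seq1 scale1r subrr /sqnorm inner0l.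
Qed.

Lemma closed_span_subspace (W : Type) (b : W -> H) :
  closed_subspace (closed_span b).
Proof.
split.
- by move=> e e0; exists [::]; rewrite big_nil subrr /sqnorm inner0l.
- move=> c u v Pu Pv e e0.
  (* [sqnormD] doubles both errors and scaling multiplies the first by |c|^2, so each must
     contribute less than e/4 before doubling; the + 1 keeps the divisor positive when c = 0. *)
  have c0 : 0 < 2 * (sqmod c + 1) by have := sqmod_ge0 c; lra.
  have [s su] := Pu _ (divr_gt0 (divr_gt0 e0 c0) (ltr0n R 2)).
  have [t tv] := Pv _ (divr_gt0 e0 (ltr0n R 4)).
  exists ([seq (c * p.1, p.2) | p <- s] ++ t).
  rewrite big_cat big_map /=.
  under eq_bigr do rewrite -scalerA.
  rewrite -scaler_sumr opprD addrACA -scalerBr.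
  apply: le_lt_trans (sqnormD _ _) _; rewrite sqnormZ.
  set x := sqnorm _ in su *; set y := sqnorm _ in tv *.
  have : (sqmod c + 1) * x < e / 4.
    have c1 : 0 < sqmod c + 1 by have := sqmod_ge0 c; lra.
    rewrite -ltr_pdivlMl//; apply: lt_le_trans su _; rewrite le_eqVlt; apply/orP; left.
    by apply/eqP; field; rewrite gt_eqF.
  have : 0 <= x by exact: sqnorm_ge0.
  by nra.
- move=> v Pv e e0.
  have [u Pu vu] := Pv _ (divr_gt0 e0 (ltr0n R 4)).
  have [s su] := Pu _ (divr_gt0 e0 (ltr0n R 4)).
  exists s; rewrite (_ : v - _ = (v - u) + (u - \sum_(p <- s) p.1 *: b p.2));
    last first.
    by rewrite addrA subrK.
  by apply: le_lt_trans (sqnormD _ _) _; nra.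
Qed.

End InnerProduct.

(** The closed span measures squared distances; hence the tolerances sqrt e and e^2 in the two
    directions. *)
Lemma monic_closed_span (R : realType) (n : nat) (O : cstarAlgebra R)
    (S : 'I_n.+1 -> O) (H : innerProductSpace R) (pi : O -> H -> H) :
  monic_representation S pi <->
  exists xi : H, forall v, closed_span
    (fun I => pi (word_prod S I * star (word_prod S I)) xi) v.
Proof.
split=> -[xi Hxi]; exists xi => v e e0.
- have [|N [c [I]]] := Hxi v (Num.sqrt e); first by rewrite sqrtr_gt0.
  rewrite ipnorm_lt ?sqrtr_gt0// sqr_sqrtr ?ltW// => h.
  exists [seq (c k, I k) | k <- enum 'I_N]; rewrite big_map /=.
  by rewrite big_enum.
- have [|s] := Hxi v (e ^+ 2); first by rewrite exprn_gt0.
  rewrite -ipnorm_lt// => h.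
  exists (size s), (fun k => (tnth (in_tuple s) k).1), (fun k => (tnth
    (in_tuple s) k).2).
  by rewrite -(big_tuple _ _ _ xpredT (fun p => p.1 *: pi (word_prod S p.2 * star
    (word_prod S p.2)) xi)).
Qed.

(** A preimage of the cyclic vector is cyclic: [U] intertwines the projections and preserves the
    approximation error. *)
Lemma monic_unitarily_equivalent (R : realType) (n : nat) (O : cstarAlgebra R)
    (S : 'I_n.+1 -> O) (H K : innerProductSpace R) (pi : O -> H -> H)
    (rho : O -> K -> K) :
  unitarily_equivalent pi rho -> monic_representation S rho ->
  monic_representation S pi.
Proof.
move=> [U [linU isoU surU intU]] /monic_closed_span[eta Heta].
apply/monic_closed_span; have [xi Uxi] := surU eta; exists xi => v e e0.
have [s hs] := Heta (U v) e e0; exists s.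
pose linU' := GRing.isLinear.Build _ _ _ _ U linU.
pose UL : {linear H -> K} := HB.pack U linU'.
rewrite /sqnorm -isoU; rewrite /sqnorm in hs.
suff -> : U (v - \sum_(p <- s) p.1 *: pi (word_prod S p.2 * star
  (word_prod S p.2)) xi) =
  U v - \sum_(p <- s) p.1 *: rho (word_prod S p.2 * star (word_prod S p.2)) eta by [].
have -> : U = UL by [].
rewrite linearB linear_sum; congr (_ - _); apply: eq_bigr => p _.
by rewrite linearZ /= intU Uxi.
Qed.

(** * Square-integrable complex functions *)

Section ComplexMeasurable.
Context d (T : measurableType d) (R : realType).
Implicit Types f g : T -> R[i].

Definition cmeasurable f : Prop :=
  measurable_fun setT (fun x => complex.Re (f x)) /\
  measurable_fun setT (fun x => complex.Im (f x)).

Lemma cmeasurable_sqmod f : cmeasurable f ->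
  measurable_fun setT (fun x => sqmod (f x)).
Proof. by move=> [mr mi]; apply: measurable_funD; exact: measurable_funX. Qed.

Lemma cmeasurableM f g : cmeasurable f -> cmeasurable g ->
  cmeasurable (fun x => f x * g x).
Proof.
move=> [fr fi] [gr gi]; split.
- under eq_fun do rewrite complexRe_mul.
  by apply: measurable_funB; exact: measurable_funM.
- under eq_fun do rewrite complexIm_mul.
  by apply: measurable_funD; exact: measurable_funM.
Qed.

Lemma cmeasurableD f g : cmeasurable f -> cmeasurable g ->
  cmeasurable (fun x => f x + g x).
Proof.
move=> [fr fi] [gr gi]; split.
- by under eq_fun do rewrite complexRe_add; exact: measurable_funD.
- by under eq_fun do rewrite complexIm_add; exact: measurable_funD.
Qed.

Lemma cmeasurable_cst c : cmeasurable (fun=> c).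
Proof. by split; exact: measurable_cst. Qed.

Lemma cmeasurableN f : cmeasurable f -> cmeasurable (fun x => - f x).
Proof.
move=> mf; have := cmeasurableM (cmeasurable_cst (-1)) mf.
by under eq_fun do rewrite mulN1r.
Qed.

(** Uses 1/z = conj z / |z|^2, which also holds at z = 0 under the convention 1/0 = 0. The real
    inverse is seen as the power of exponent -1 to get its measurability. *)
Lemma cmeasurableV f : cmeasurable f -> cmeasurable (fun x => (f x)^-1).
Proof.
move=> mf.
have mV : measurable_fun setT (fun x => (sqmod (f x))^-1).
  under eq_fun do rewrite -powR_inv1 ?sqmod_ge0//.
  exact: (measurableT_comp (measurable_powR _)) (cmeasurable_sqmod mf).
have [fr fi] := mf; split.
- rewrite (_ : (fun _ => _) = (fun x => complex.Re (f x) * (sqmod (f x))^-1)).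
    exact: measurable_funM.
  by apply/funext => x; case: (f x) => a b.
- rewrite (_ : (fun _ => _) = (fun x => - (complex.Im (f x) * (sqmod (f x))^-1))).
    by apply: measurableT_comp => //; exact: measurable_funM.
  by apply/funext => x; case: (f x) => a b.
Qed.

Lemma cmeasurable_sum (I : Type) (s : seq I) (f : I -> T -> R[i]) :
  (forall i, cmeasurable (f i)) -> cmeasurable (fun x => \sum_(i <- s) f i x).
Proof.
move=> mf; elim: s => [|i s IH].
  by under eq_fun do rewrite big_nil; exact: cmeasurable_cst.
by under eq_fun do rewrite big_cons; exact: cmeasurableD.
Qed.

Definition cindic (E : set T) : T -> R[i] := fun x => (\1_E x : R)%:C%C.

Lemma cindicE (E : set T) x : cindic E x = (x \in E)%:R.
Proof. by rewrite /cindic indicE rmorph_nat. Qed.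

Lemma sqmod_cindic E x : sqmod (cindic E x) = \1_E x.
Proof. by rewrite /sqmod /= indicE; case: (x \in E);
  rewrite ?expr1n !expr0n ?addr0. Qed.

Lemma cmeasurable_cindic E : measurable E -> cmeasurable (cindic E).
Proof. by move=> mE; split; [exact: measurable_indic|exact: measurable_cst]. Qed.

Lemma cmeasurable_preimage f (E : set R) : cmeasurable f ->
  measurable E -> measurable [set x | E (sqmod (f x))].
Proof.
move=> /cmeasurable_sqmod mf mE.
by have := mf measurableT _ mE; rewrite setTI.
Qed.

Lemma cmeasurable_eq f c : cmeasurable f -> measurable [set x | f x = c].
Proof.
move=> mf; rewrite (_ : [set _ | _] = [set x | [set 0] (sqmod (f x + - c))]).
  apply: (@cmeasurable_preimage (fun x => f x + - c)) => //.
  exact: cmeasurableD mf (cmeasurable_cst _).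
apply/seteqP; split => x /=; first by move=> ->; rewrite subrr sqmod0.
by move=> /sqmod_eq0 /eqP; rewrite subr_eq0 => /eqP.
Qed.

End ComplexMeasurable.

Arguments cindic {d T} R E.

Lemma cmeasurable_comp d d' (T : measurableType d) (T' : measurableType d')
    (R : realType) (F : T -> T') (f : T' -> R[i]) :
  measurable_fun setT F -> cmeasurable f -> cmeasurable (f \o F).
Proof. by move=> mF [fr fi]; split;
  [exact: measurableT_comp fr mF|exact: measurableT_comp fi mF]. Qed.

Section ComplexL2.
Context d (T : measurableType d) (R : realType).
Variable mu : {measure set T -> \bar R}.

Lemma Lfun2P (f : T -> R) : f \in Lfun mu 2%:E <->
  measurable_fun setT f /\ (\int[mu]_x (f x ^+ 2)%:E < +oo)%E.
Proof.
split=> [lf|[mf lf]].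
  split; first by move: lf; rewrite inE => /andP[]; rewrite inE.
  have /integrableP[_] := Lfun2_integrable_sqr lf; apply: le_lt_trans.
  rewrite le_eqVlt; apply/orP; left; apply/eqP; apply: eq_integral => x _ /=.
  by rewrite ger0_norm// sqr_ge0.
rewrite inE; apply/andP; split; rewrite inE//=.
rewrite /finite_norm unlock /=.
apply: poweR_lty; apply: le_lt_trans lf; rewrite le_eqVlt; apply/orP; left.
apply/eqP; apply: eq_integral => x _ /=.
by rewrite powR_mulrn// real_normK// num_real.
Qed.

Lemma CLfun2P (f : T -> R[i]) : f \in CLfun2 mu <->
  cmeasurable f /\ (\int[mu]_x (sqmod (f x))%:E < +oo)%E.
Proof.
have sE : measurable_fun setT (fun x => complex.Re (f x)) ->
    measurable_fun setT (fun x => complex.Im (f x)) ->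
    (\int[mu]_x (sqmod (f x))%:E = \int[mu]_x (complex.Re (f x) ^+ 2)%:E +
      \int[mu]_x (complex.Im (f x) ^+ 2)%:E)%E.
  move=> mr mi; under eq_integral do rewrite EFinD.
  rewrite ge0_integralD//.
  - by move=> x _; rewrite lee_fin sqr_ge0.
  - by apply/measurable_EFinP; exact: measurable_funX.
  - by move=> x _; rewrite lee_fin sqr_ge0.
  - by apply/measurable_EFinP; exact: measurable_funX.
rewrite inE; split=> [/andP[/Lfun2P[mr lr] /Lfun2P[mi li]]|[[mr mi]]].
  by split=> //; rewrite sE//; exact: lte_add_pinfty.
rewrite sE// => h; apply/andP; split; apply/Lfun2P; split=> //;
  apply: le_lt_trans h.
- by rewrite leeDl// integral_ge0// => x _; rewrite lee_fin sqr_ge0.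
- by rewrite leeDr// integral_ge0// => x _; rewrite lee_fin sqr_ge0.
Qed.

Lemma L2_cmeasurable (u : L2 mu) : cmeasurable (u : T -> R[i]).
Proof. by have /CLfun2P[] : (u : T -> R[i]) \in CLfun2 mu by exact: l2valP. Qed.

Lemma L2_CLfun2 (u : L2 mu) : (u : T -> R[i]) \in CLfun2 mu.
Proof. exact: l2valP. Qed.

Lemma ae_eq_integral_sqmod (f g : T -> R[i]) :
  cmeasurable f -> cmeasurable g -> {ae mu, forall x, f x = g x} ->
  (\int[mu]_x (sqmod (f x))%:E = \int[mu]_x (sqmod (g x))%:E)%E.
Proof.
move=> mf mg fg; apply: ae_eq_integral => //.
- by apply/measurable_EFinP; exact: cmeasurable_sqmod.
- by apply/measurable_EFinP; exact: cmeasurable_sqmod.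
- by apply: filterS fg => x ->.
Qed.

(* The junk value is 0 when f is not square integrable. *)
Definition toL2 (f : T -> R[i]) : L2 mu := L2class (insubd (0 : L2fun mu) f).

Lemma toL2_ae (f : T -> R[i]) : f \in CLfun2 mu ->
  {ae mu, forall x, toL2 f x = f x}.
Proof.
move=> Lf; apply: filterS (L2class_ae (insubd (0 : L2fun mu) f)) => x ->.
by rewrite -/(val _ x) val_insubd Lf.
Qed.

Lemma sqnorm_L2 (u : L2space mu) :
  ((sqnorm u)%:E = \int[mu]_x (sqmod ((u : L2 mu) x))%:E)%E.
Proof.
have E : sqnorm u = \int[mu]_x (sqmod ((u : L2 mu) x)).
  by apply: eq_Rintegral => x _; rewrite mul_conjc.
rewrite E /Rintegral fineK// ge0_fin_numE ?integral_ge0//.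
  by have /CLfun2P[] := L2_CLfun2 u.
by move=> x _; rewrite lee_fin sqmod_ge0.
Qed.

Lemma sqnorm_L2_ae (u : L2space mu) (f : T -> R[i]) : cmeasurable f ->
  {ae mu, forall x, (u : L2 mu) x = f x} ->
  ((sqnorm u)%:E = \int[mu]_x (sqmod (f x))%:E)%E.
Proof.
by move=> mf uf; rewrite sqnorm_L2; apply: ae_eq_integral_sqmod => //;
  exact: L2_cmeasurable.
Qed.

Lemma L2opp_ae (u : L2 mu) : {ae mu, forall x, (- u : L2 mu) x = - u x}.
Proof.
rewrite -(scaleN1r (u : L2 mu)); apply: filterS (L2scale_ae (-1) u) => x.
by rewrite mulN1r.
Qed.

Lemma L2sub_ae (u v : L2 mu) : {ae mu, forall x, (u - v : L2 mu) x = u x - v x}.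
Proof. by apply: filterS2 (L2add_ae u (- v)) (L2opp_ae v) => x -> ->. Qed.

Lemma L2zero_ae : {ae mu, forall x, (0 : L2 mu) x = 0}.
Proof.
rewrite -(subrr (0 : L2 mu)); apply: filterS (L2sub_ae 0 0) => x ->.
exact: subrr.
Qed.

Lemma L2sum_ae (I : Type) (s : seq I) (u : I -> L2 mu) (f : I -> T -> R[i]) :
  (forall i, {ae mu, forall x, u i x = f i x}) ->
  {ae mu, forall x, (\sum_(i <- s) u i : L2 mu) x = \sum_(i <- s) f i x}.
Proof.
move=> uf; elim: s => [|i s IH].
  by rewrite big_nil; apply: filterS L2zero_ae => x ->; rewrite big_nil.
rewrite big_cons; have h := L2add_ae (u i) (\sum_(j <- s) u j).
apply: filterS3 h (uf i) IH => x.
by move=> -> -> ->; rewrite big_cons.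
Qed.

End ComplexL2.

Section FiniteMeasure.
Context d (T : measurableType d) (R : realType) (mu : probability T R).

Lemma cindic_CLfun2 E : measurable E -> cindic R E \in CLfun2 mu.
Proof.
move=> mE; apply/CLfun2P; split; first exact: cmeasurable_cindic.
under eq_integral do rewrite sqmod_cindic.
by rewrite integral_indic// setIT; apply: le_lt_trans (probability_le1 mu mE) _;
  exact: ltry.
Qed.

Lemma toL2_cindic_ae E : measurable E ->
  {ae mu, forall x, toL2 mu (cindic R E) x = cindic R E x}.
Proof. by move=> mE; apply: toL2_ae; exact: cindic_CLfun2. Qed.

End FiniteMeasure.

(** * Density of indicator functions *)

Section Density.
Import HBNNSimple.
Local Open Scope ereal_scope.
Context d (T : measurableType d) (R : realType) (mu : probability T R).
Variable P : set (L2space mu).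
Hypothesis HP : closed_subspace P.

(** Dominated convergence, applied to the squared errors, turns pointwise convergence into
    convergence in L^2. *)
Lemma closed_subspace_dominated (f_ : nat -> T -> R[i]) (f : T -> R[i]) (g : T -> R) :
  (forall n, f_ n \in CLfun2 mu) -> f \in CLfun2 mu ->
  (forall n, P (toL2 mu (f_ n))) ->
  (forall x, (sqmod (f x - f_ n x))%:E @[n --> \oo] --> 0) ->
  mu.-integrable setT (EFin \o g) ->
  (forall n x, (sqmod (f x - f_ n x) <= g x)%R) ->
  P (toL2 mu f).
Proof.
move=> Lf_ Lf Pf_ cvf ig leg.
have [_ _ Pcl] := HP; apply: Pcl => e e0.
have mB n : cmeasurable (fun x => (f x + - f_ n x)%R).
  apply: cmeasurableD; first by have /CLfun2P[] := Lf.
  by apply: cmeasurableN; have /CLfun2P[] := Lf_ n.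
have snE n : (sqnorm (toL2 mu f - toL2 mu (f_ n) : L2space mu))%:E =
    \int[mu]_x (sqmod (f x - f_ n x))%:E.
  apply: sqnorm_L2_ae; first exact: mB.
  have h := L2sub_ae (toL2 mu f) (toL2 mu (f_ n)).
  by apply: filterS3 h (toL2_ae Lf) (toL2_ae (Lf_ n)) => x -> -> ->.
have leg' : {ae mu, forall x n, setT x -> `|(sqmod (f x - f_ n x))%:E| <=
  (EFin \o g) x}.
  by apply: aeW => x n _ /=; rewrite lee_fin ger0_norm ?leg// sqmod_ge0.
have [_ _] := dominated_convergence measurableT
  (fun n => (measurable_EFinP _ _).2 (cmeasurable_sqmod (mB n)))
  (measurable_cst _) (aeW _ (fun x _ => cvf x)) ig leg'.
rewrite integral0.
under eq_fun do rewrite -snE.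
move=> /fine_cvgP[_] /cvgrPdist_lt /(_ _ e0) [N _ /(_ N (leqnn N))] /=.
rewrite sub0r normrN ger0_norm ?sqnorm_ge0// => h.
by exists (toL2 mu (f_ N)).
Qed.

Lemma CLfun2_lincomb (c : R[i]) (f g : T -> R[i]) :
  f \in CLfun2 mu -> g \in CLfun2 mu ->
  (fun x => (c * f x + g x)%R) \in CLfun2 mu.
Proof. by have [_ cl] := CLfun2_submod_closed mu; exact: cl. Qed.

Lemma toL2_lincomb (c : R[i]) (f g : T -> R[i]) :
  f \in CLfun2 mu -> g \in CLfun2 mu ->
  toL2 mu (fun x => (c * f x + g x)%R) = (c *: toL2 mu f + toL2 mu g)%R.
Proof.
move=> Lf Lg; apply/L2_eqP.
have Lfg := CLfun2_lincomb c Lf Lg.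
have h1 := toL2_ae Lfg; have h2 := L2add_ae (c *: toL2 mu f) (toL2 mu g).
have h3 := L2scale_ae c (toL2 mu f).
by apply: filterS (filterI (filterI h1 (filterI h2 h3)) (filterI (toL2_ae Lf)
  (toL2_ae Lg))) => x [[-> [-> ->]] [-> ->]].
Qed.

Lemma closed_subspace_lincomb (c : R[i]) (f g : T -> R[i]) :
  f \in CLfun2 mu -> g \in CLfun2 mu -> P (toL2 mu f) -> P (toL2 mu g) ->
  P (toL2 mu (fun x => (c * f x + g x)%R)).
Proof.
by move=> Lf Lg Pf Pg; rewrite toL2_lincomb//; have [_ PL _] := HP; apply: PL.
Qed.

Lemma integrable_one : mu.-integrable setT (EFin \o (cst 1%R : T -> R)).
Proof. by apply/Lfun1_integrable; exact: Lfun_cst. Qed.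

(** Dynkin's pi-lambda argument: the sets whose indicator lies in [P] form a lambda-system, proper
    differences by linearity and increasing unions by dominated convergence. *)
Lemma closed_subspace_measurable (G : set (set T)) :
  measurable = <<s G >> -> setI_closed G ->
  (forall E, G E -> P (toL2 mu (cindic R E))) ->
  P (toL2 mu (cindic R setT)) ->
  forall E, measurable E -> P (toL2 mu (cindic R E)).
Proof.
move=> mG GI PG PT.
suff : <<s G >> `<=` [set E | measurable E /\ P (toL2 mu (cindic R E))].
  by move=> sub E; rewrite mG => /sub[].
apply: lambda_system_subset => //; last first.
  by move=> E GE; split; [rewrite mG; exact: sub_gen_smallest|exact: PG].
split => //.
- move=> A B BA [mA PA] [mB PB]; split; first exact: measurableD.
  rewrite (_ : cindic R _ = (fun x => -1 * cindic R B x + cindic R A x)%R).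
    by apply: closed_subspace_lincomb => //; exact: cindic_CLfun2.
  apply/funext => x; rewrite !cindicE in_setD.
  have [xB|] := boolP (x \in B); last by rewrite andbT mulr0 add0r.
  have -> : x \in A by rewrite inE; apply: BA; rewrite -inE.
  by rewrite mulr1 addNr.
- move=> F ndF HF.
  have mF n : measurable (F n) by have [] := HF n.
  split.
    exact: bigcupT_measurable.
  (* At each point the indicators of an increasing sequence are eventually constant, and their
     errors are bounded by 1, which is integrable for a probability. *)
  apply: (@closed_subspace_dominated (fun n => cindic R (F n)) _ (cst 1%R)).
  + by move=> n; exact: cindic_CLfun2.
  + by apply: cindic_CLfun2; exact: bigcupT_measurable.
  + by move=> n; have [] := HF n.
  + move=> x; apply: cvg_near_cst.
    have [[k _ Fkx]|nF] := pselect ((\bigcup_n F n) x).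
      exists k => // n /= kn.
      have Fnx : F n x by have /subsetPset := ndF _ _ kn; apply.
      by rewrite !cindicE !mem_set ?subrr ?sqmod0//; exists n.
    exists 0%N => // n _.
    have nFnx : ~ F n x by apply: contra_not nF => Fnx; exists n.
    by rewrite !cindicE !memNset ?subrr ?sqmod0.
  + exact: integrable_one.
  + move=> n x /=; rewrite !cindicE.
    by case: (x \in _); case: (x \in _);
      rewrite /sqmod /= ?subrr ?subr0 ?sub0r ?sqrrN ?expr1n ?expr0n ?oppr0 ?expr0n
        ?addr0 ?ler01.
Qed.

Hypothesis PI : forall E, measurable E -> P (toL2 mu (cindic R E)).

(** Square integrability is carried through the induction because [toL2] is only meaningful on
    square-integrable functions. *)
Lemma closed_subspace_simple (h : {nnsfun T >-> R}) :
  (fun x => (h x)%:C%C) \in CLfun2 mu /\ P (toL2 mu (fun x => (h x)%:C%C)).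
Proof.
have mh y : measurable (h @^-1` [set y]) by exact: measurable_funPTI.
pose F (s : seq R) x := (\sum_(y <- s) (y * \1_(h @^-1` [set y]) x)%:C%C)%R : R[i].
have -> : (fun x => (h x)%:C%C) = F (finmap.enum_fset (fset_set (range h))).
  by apply/funext => x; rewrite /F -rmorph_sum/= [in LHS]fimfunE fsbig_finite.
elim: (X in F X) => [|y s [Ls Ps]].
  have -> : F [::] = cst 0%R by apply/funext => x; rewrite /F big_nil.
  have L0 : cst 0%R \in CLfun2 mu by have [] := CLfun2_submod_closed mu.
  split => //; have [P0 _ _] := HP; rewrite (_ : toL2 _ _ = 0%R)//.
  apply/L2_eqP; have h0 := L2zero_ae mu.
  by apply: filterS2 (toL2_ae L0) h0 => x -> ->.
have -> : F (y :: s) = (fun x => y%:C%C * cindic R (h @^-1` [set y]) x + F s x)%R.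
  by apply/funext => x; rewrite /F big_cons rmorphM.
have Li := cindic_CLfun2 mu (mh y).
split; last by apply: closed_subspace_lincomb => //; exact: PI.
exact: CLfun2_lincomb.
Qed.

Lemma closed_subspace_nonneg (h : T -> R) : measurable_fun setT h ->
  (forall x, 0 <= h x)%R -> (fun x => (h x)%:C%C) \in CLfun2 mu ->
  P (toL2 mu (fun x => (h x)%:C%C)).
Proof.
move=> mh h0 Lh.
pose f_ := nnsfun_approx measurableT ((measurable_EFinP _ _).2 mh).
have cvf x : f_ n x @[n --> \oo] --> h x.
  have h0' y : [set: T] y -> 0 <= (EFin \o h) y by rewrite lee_fin.
  by have /fine_cvgP[] := cvg_nnsfun_approx measurableT
    ((measurable_EFinP _ _).2 mh) (h0') (Logic.I : [set: T] x).
have lef n x : (f_ n x <= h x)%R.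
  rewrite -(cvg_lim (@Rhausdorff R) (cvf x)).
  apply: (@nondecreasing_cvgn_le _ (fun n => f_ n x)); last by apply/cvg_ex;
    exists (h x).
  by move=> a b ab; have /lefP := nd_nnsfun_approx measurableT
    ((measurable_EFinP _ _).2 mh) ab; apply.
have sE n x : sqmod ((h x)%:C%C - (f_ n x)%:C%C)%R = ((h x - f_ n x) ^+ 2)%R.
  by rewrite /sqmod /= subrr expr0n addr0.
(* The approximants satisfy 0 <= f_n <= h, so the squared error is at most h^2, integrable because h
   is in L^2. *)
apply: (@closed_subspace_dominated (fun n x => (f_ n x)%:C%C) _
  (fun x => h x ^+ 2)%R) => //.
- by move=> n; have [] := closed_subspace_simple (f_ n).
- by move=> n; have [] := closed_subspace_simple (f_ n).
- move=> x; under eq_fun do rewrite sE.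
  apply: cvg_EFin; first exact: nearW.
  rewrite /comp /= -[X in _ --> X](expr0n R 2) -[X in (X ^+ 2)%R](subrr (h x)).
  rewrite expr2; under eq_fun do rewrite expr2.
  by apply: cvgM; apply: cvgB => //; exact: cvg_cst.
- apply: Lfun2_integrable_sqr; move: Lh.
  by rewrite inE => /andP[].
- move=> n x; rewrite sE ler_sqr ?nnegrE ?subr_ge0 ?lerBlDr ?lerDl//.
Qed.

Local Close Scope ereal_scope.

Lemma closed_subspace_full (v : L2 mu) : P v.
Proof.
have LC (h : T -> R) : h \in Lfun mu 2%:E -> (fun x => (h x)%:C%C) \in CLfun2 mu.
  by move=> Lh; rewrite inE; apply/andP; split => //=; exact: Lfun_cst.
have nn (h : T -> R) : h \in Lfun mu 2%:E -> (fun x => Num.max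
  (h x) 0) \in Lfun mu 2%:E.
  move=> /Lfun2P[mh lh]; apply/Lfun2P; split.
    exact: measurable_maxr.
  apply: le_lt_trans lh; apply: ge0_le_integral => //.
  - by move=> x _; rewrite lee_fin sqr_ge0.
  - by apply/measurable_EFinP; apply: measurable_funX; exact: measurable_maxr.
  - by apply/measurable_EFinP; exact: measurable_funX.
  - move=> x _; rewrite lee_fin; case: (leP (h x) 0) => _ //.
    by rewrite expr0n sqr_ge0.
have PR (h : T -> R) : h \in Lfun mu 2%:E -> P (toL2 mu (fun x => (h x)%:C%C)).
  move=> Lh; pose h' := fun x => (- h x).
  have Lh' : h' \in Lfun mu 2%:E.
    have /Lfun2P[mh lh] := Lh; apply/Lfun2P; split; first exact: measurableT_comp.
    by under eq_integral do rewrite sqrrN.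
  (* A real function is its positive part minus its negative part, the latter being the positive
     part of h' = -h. *)
  rewrite (_ : (fun _ => _) = (fun x => -1 * (Num.max (h' x) 0)%:C%C + (Num.max
    (h x) 0)%:C%C)).
    apply: closed_subspace_lincomb; try by apply: LC; exact: nn.
    - apply: closed_subspace_nonneg; [|by move=> x;
      rewrite le_max lexx orbT|by apply: LC; exact: nn].
      by have /Lfun2P[] := nn _ Lh'.
    - apply: closed_subspace_nonneg; [|by move=> x;
      rewrite le_max lexx orbT|by apply: LC; exact: nn].
      by have /Lfun2P[] := nn _ Lh.
  apply/funext => x; rewrite mulN1r -rmorphN -rmorphD /= /h'; congr (_%:C%C).
  case: (leP (- h x) 0); case: (leP (h x) 0); lra.
have /andP[Lr Li] := L2_CLfun2 v.
have E : v = toL2 mu (fun x => 'i%C * (complex.Im (v x))%:C%C + (complex.Re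
  (v x))%:C%C).
  apply/L2_eqP; have L : (fun x => 'i%C * (complex.Im (v x))%:C%C + (complex.Re
    (v x))%:C%C) \in CLfun2 mu.
    by apply: CLfun2_lincomb; exact: LC.
  apply: filterS (toL2_ae L) => x ->; case: (v x) => a b.
  by apply/eqP; rewrite eq_complex /=; apply/andP; split; apply/eqP; ring.
by rewrite E; apply: closed_subspace_lincomb; do ?[exact: LC|exact: PR].
Qed.

End Density.

(** * Borel structure of the topological Markov chain *)

Section Cylinders.
Variables (n : nat) (A : 'M[nat]_n.+1) (HA : primitive01 A).
Local Notation XB := (markovChainBorel HA).

Definition mc_cylinder (I : seq 'I_n.+1) : set XB :=
  [set x | mkseq (sval x) (size I) = I].

Lemma mc_open_cylinder (U : set (markovChainTop HA)) (x : markovChainTop HA) :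
  open U -> U x -> exists N, forall y : XB,
    mkseq (sval y) N = mkseq (sval x) N -> U y.
Proof.
move=> [V oV <-] Vx.
(* [G] is the filter of sets containing all sequences that share some finite prefix with x. It
   converges to x coordinatewise, hence in the product topology, so the open set [V] belongs to
   it. *)
pose G : set_system {ptws nat -> discrete_topology 'I_n.+1} :=
  [set W | exists N, forall y, mkseq y N = mkseq (sval x) N -> W y].
have FG : Filter G.
  split.
  - by exists 0%N.
  - move=> P Q [N1 H1] [N2 H2]; exists (maxn N1 N2) => y yx.
    have take_mkseq N z : (N <= maxn N1 N2)%N ->
        mkseq z N = take N (mkseq z (maxn N1 N2)) :> seq 'I_n.+1.
      by move=> NN; rewrite -map_take take_iota (minn_idPl NN).
    split; [apply: H1|apply: H2].
    + by rewrite (take_mkseq N1 y) ?(take_mkseq N1 (sval x)) ?leq_maxl// yx.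
    + by rewrite (take_mkseq N2 y) ?(take_mkseq N2 (sval x)) ?leq_maxr// yx.
  - by move=> P Q PQ [N HN]; exists N => y /HN /PQ.
have Gx : {ptws, G --> (sval x : nat -> discrete_topology 'I_n.+1)}.
  apply/pointwise_cvgP => t; apply/discrete_cvg.
  exists t.+1 => y yx /=.
  by have := congr1 (fun s => nth ord0 s t) yx; rewrite !nth_mkseq.
have [N HN] : G V by apply: Gx; exact: open_nbhs_nbhs.
by exists N => y /HN.
Qed.

(** Words are countable, so this writes an open set as a countable union of cylinders and reduces
    Borel measurability to coordinates. *)
Lemma mc_open_bigcup (U : set (markovChainTop HA)) : open U ->
  U = \bigcup_(I in [set I | mc_cylinder I `<=` U]) mc_cylinder I.
Proof.
move=> oU; apply/seteqP; split => [x Ux|x [I IU Ix]]; last exact: IU.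
have [N HN] := mc_open_cylinder oU Ux.
exists (mkseq (sval x) N); last by rewrite /mc_cylinder /= size_mkseq.
by move=> y; rewrite /mc_cylinder /= size_mkseq => /HN.
Qed.

Lemma mc_coord_measurable k (i : 'I_n.+1) :
  measurable ([set x | sval x k = i] : set XB).
Proof.
apply: sub_sigma_algebra.
exists ((fun y : {ptws nat -> discrete_topology 'I_n.+1} => y k) @^-1` [set i]) => //.
apply: open_comp; last exact: discrete_open.
by move=> y _; exact: (@proj_continuous nat (fun=> discrete_topology 'I_n.+1) k y).
Qed.

Lemma mc_cylinder_bigcap I : mc_cylinder I =
  \bigcap_(k in `I_(size I)) [set x | sval x k = nth ord0 I k].
Proof.
apply/seteqP; split => [x xI k /= kI|x xI]; first by rewrite -xI nth_mkseq.
apply: (@eq_from_nth _ ord0); rewrite ?size_mkseq// => k kI.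
by rewrite nth_mkseq//; exact: xI.
Qed.

Lemma mc_measurable_fun d (Y : measurableType d) (E : set Y) (F : Y -> XB) :
  (forall k i, measurable (E `&` [set y | sval (F y) k = i])) ->
  measurable_fun E F.
Proof.
move=> mF mE; have := @measurability _ _ Y XB E F (@open
  (markovChainTop HA)) erefl; apply => //.
move=> _ [U oU <-]; rewrite (mc_open_bigcup oU) preimage_bigcup setI_bigcupr.
rewrite bigcup_mkcond; apply: countable_bigcupT_measurable => [|I];
  first exact: countableP.
case: ifP => // _; rewrite mc_cylinder_bigcap preimage_bigcap.
(* The hypothesis only controls coordinate sets within [E]. The outer [E] is kept for the empty
   word, where the intersection is the whole space. *)
rewrite (_ : E `&` _ = E `&` \bigcap_(k in `I_(size I)) (E `&` [set y | sval
  (F y) k = nth ord0 I k])).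
  apply: measurableI => //; apply: fin_bigcap_measurable => //.
apply/seteqP; split => y [Ey Hy]; split => // k kI; first by split => //; exact: Hy.
by have [] := Hy k kI.
Qed.

Lemma mc_cylinder_measurable I : measurable (mc_cylinder I).
Proof.
rewrite mc_cylinder_bigcap; apply: fin_bigcap_measurable => // k _.
exact: mc_coord_measurable.
Qed.

(** Cylinders of incompatible words are disjoint, and no cylinder is empty when all words are
    admissible; [set0] is added to obtain a pi-system. *)
Definition mc_cylinders : set (set XB) :=
  [set E | E = set0 \/ exists I, E = mc_cylinder I].

Lemma mc_cylinder_nil : mc_cylinder [::] = setT.
Proof. by apply/seteqP. Qed.

Lemma mc_cylinders_setI : setI_closed mc_cylinders.
Proof.
move=> _ B [->|[I ->]]; first by rewrite set0I; left.
move=> [->|[J ->]]; first by rewrite setI0; left.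
have [->|/set0P[z [zI zJ]]] := eqVneq (mc_cylinder I `&` mc_cylinder J) set0.
  by left.
(* Two cylinders with a common point z are nested: both words are prefixes of z, so the shorter is a
   prefix of the longer. *)
have sub K L : (size K <= size L)%N -> mc_cylinder K z -> mc_cylinder L z ->
    mc_cylinder L `<=` mc_cylinder K.
  move=> KL zK zL y yL; rewrite /mc_cylinder /= -[RHS]zK.
  apply: (@eq_from_nth _ ord0); rewrite ?size_mkseq// => k kK.
  have kL := leq_trans kK KL.
  have := congr1 (fun s => nth ord0 s k) (etrans yL (esym zL)).
  by rewrite !nth_mkseq.
right; have [IJ|/ltnW JI] := leqP (size I) (size J).
  by exists J; apply/setIidPr; exact: sub.
by exists I; apply/setIidPl; exact: sub.
Qed.

Lemma mc_measurableE : measurable = <<s mc_cylinders >>.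
Proof.
apply/seteqP; split.
  apply: smallest_sub; first exact: smallest_sigma_algebra.
  move=> U oU; rewrite (mc_open_bigcup oU) bigcup_mkcond.
  apply: (@countable_bigcupT_measurable _ (g_sigma_algebraType mc_cylinders)).
    exact: countableP.
  move=> I; case: ifP => // _; apply: sub_sigma_algebra.
  by right; exists I.
apply: smallest_sub; first exact: sigma_algebra_measurable.
by move=> _ [->//|[I ->]]; exact: mc_cylinder_measurable.
Qed.

Lemma mc_shift_measurable : measurable_fun setT (@mc_shift n A HA).
Proof.
by apply: mc_measurable_fun => k i; rewrite setTI; exact: (mc_coord_measurable k.+1 i).
Qed.

Lemma mc_consE (i : 'I_n.+1) (x : XB) : mc_dom i x ->
  sval (mc_cons i x) = mc_cons_seq i (sval x).
Proof.
move=> ix; rewrite /mc_cons; case: pselect => // h; exfalso; apply: h.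
by case=> [|k] //=; exact: (svalP x k).
Qed.

Lemma mc_eqP (x y : XB) : sval x =1 sval y -> x = y.
Proof.
case: x y => [x hx] [y hy] /= /funext xy; subst y; congr exist.
exact: Prop_irrelevance.
Qed.

Lemma mc_shift_cons i (x : XB) : mc_dom i x -> mc_shift (mc_cons i x) = x.
Proof. by move=> ix; apply: mc_eqP => k /=; rewrite mc_consE. Qed.

Lemma mc_dom_shift (x : XB) : mc_dom (sval x 0%N) (mc_shift x).
Proof. exact: (svalP x 0%N). Qed.

Lemma mc_cons_shift (x : XB) : mc_cons (sval x 0%N) (mc_shift x) = x.
Proof.
by apply: mc_eqP => -[|k]; rewrite mc_consE//; exact: mc_dom_shift.
Qed.

Lemma mc_dom_measurable i : measurable (mc_dom i : set XB).
Proof.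
rewrite (_ : mc_dom i = \bigcup_(j in [set j | A i j = 1%N]) [set x | sval x 0%N = j]).
  by apply: fin_bigcup_measurable => // j _; exact: mc_coord_measurable.
apply/seteqP; split => [x ix|x [j ij xj]]; last by rewrite /mc_dom /= xj.
by exists (sval x 0%N).
Qed.

(** Images under concatenation become preimages under the shift, which makes their measurability
    elementary. *)
Lemma mc_image_cons i (C : set XB) : C `<=` mc_dom i ->
  mc_cons i @` C = [set x | sval x 0%N = i] `&` (@mc_shift n A HA) @^-1` C.
Proof.
move=> Ci; apply/seteqP; split => [_ [y Cy <-]|x [<- Cx]].
  by rewrite /= mc_consE ?mc_shift_cons//; do ?[exact: Ci].
by exists (mc_shift x) => //; exact: mc_cons_shift.
Qed.

Lemma mc_range i : sfs_range (@mc_dom n A HA)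
  (@mc_cons n A HA) i = [set x | sval x 0%N = i].
Proof.
rewrite /sfs_range mc_image_cons//; apply/setIidPl => x /= <-.
exact: mc_dom_shift.
Qed.

Lemma mc_cons_measurable i : measurable_fun (mc_dom i : set XB) (mc_cons i).
Proof.
apply: mc_measurable_fun => -[|k] j.
- have [->|ij] := eqVneq i j.
    rewrite (_ : _ `&` _ = mc_dom j); first exact: mc_dom_measurable.
    by apply/setIidPl => x jx /=; rewrite mc_consE.
  rewrite (_ : _ `&` _ = set0)//; apply/seteqP; split => // x [ix] /=.
  by rewrite mc_consE//= => /eqP; rewrite (negbTE ij).
- rewrite (_ : _ `&` _ = mc_dom i `&` [set x | sval x k = j]).
    by apply: measurableI; [exact: mc_dom_measurable|exact: mc_coord_measurable].
  by apply/seteqP; split => x [ix] /=; rewrite mc_consE.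
Qed.

Lemma mc_cons_inj i : set_inj (mc_dom i : set XB) (mc_cons i).
Proof.
move=> x y /set_mem ix /set_mem iy xy.
by rewrite -(mc_shift_cons ix) -(mc_shift_cons iy) xy.
Qed.

End Cylinders.

(** * Itineraries and range projections *)

Lemma star1 (R : realType) (O : cstarAlgebra R) : star (1 : O) = 1.
Proof.
have <- : star (star (1 : O) * 1) = star 1 by rewrite starM starK mulr1.
by rewrite mulr1 starK.
Qed.

Section Representation.
Context (R : realType) (O : cstarAlgebra R) (H : innerProductSpace R).
Variable pi : O -> H -> H.
Hypothesis Hpi : is_representation pi.

Lemma representation0 v : pi 0 v = 0.
Proof.
have [_ lin _ _ _] := Hpi; have := lin 1 0 0 v; rewrite scale1r addr0 scale1r.
by move=> /(congr1 (fun w => w - pi 0 v)); rewrite subrr addrK.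
Qed.

Lemma representation_sum (I : Type) (r : seq I) (a : I -> O) v :
  pi (\sum_(i <- r) a i) v = \sum_(i <- r) pi (a i) v.
Proof.
elim: r => [|i r IH]; first by rewrite !big_nil representation0.
rewrite !big_cons -IH; have [_ lin _ _ _] := Hpi.
by have := lin 1 (a i) (\sum_(j <- r) a j) v; rewrite !scale1r.
Qed.

End Representation.

(** * Null sets and itineraries of a semibranching function system *)

Section SemibranchingSystem.
Context d (X : measurableType d) (R : realType) (m : probability X R).
Context (n : nat) (D : 'I_n.+1 -> set X) (s : 'I_n.+1 -> X -> X) (sigma : X -> X).
Hypothesis Hsfs : is_sfs m D s sigma.
Local Notation Rg := (sfs_range D s).

Lemma sfs_measurable_range i : measurable (Rg i).
Proof. exact: (sfs_measurable_image Hsfs (sfs_measurable_dom Hsfs i)). Qed.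

Lemma sfs_push_null i Z : measurable Z -> m Z = 0%E ->
  {ae m, forall x, ~ (s i @` (Z `&` D i)) x}.
Proof.
move=> mZ Z0; exists (s i @` (Z `&` D i)); split.
- apply: (sfs_measurable_image Hsfs) => //.
  by apply: measurableI => //; exact: sfs_measurable_dom Hsfs i.
- exact: ((null_content_dominatesP _ _).1 (sfs_dominated Hsfs i) Z).
- by move=> x /= /contrapT.
Qed.

(** The exceptional set of the coding relation lies in D_i; its image in R_i is null because m o
    sigma_i << m. *)
Lemma sfs_rangeK : {ae m, forall x, forall i, Rg i x -> D i (sigma x) /\ s i
  (sigma x) = x}.
Proof.
apply: filter_forall => i.
have [Z [mZ Z0 ZP]] := sfs_coding Hsfs i.
apply: filterS (sfs_push_null i mZ Z0) => x nx [y Dy yx].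
have sy : sigma (s i y) = y.
  apply: contrapT => ny; apply: nx; exists y => //; split => //.
  by apply: ZP => /=; apply: contra_not ny; exact.
by rewrite -yx sy.
Qed.

Lemma sfs_range_partition : {ae m, forall x, exists i, forall j, Rg j x <-> i = j}.
Proof.
have dis : {ae m, forall x, forall i j, i != j -> ~ (Rg i `&` Rg j) x}.
  apply: filter_forall => i; apply: filter_forall => j.
  have [->|ij] := eqVneq i j; first by apply: aeW => x.
  exists (Rg i `&` Rg j); split.
  - by apply: measurableI; exact: sfs_measurable_range.
  - exact: (sfs_disjoint Hsfs).
  - by move=> x /= h; apply: contrapT => nx; apply: h.
have cov : {ae m, forall x, exists i, Rg i x}.
  exists (~` \bigcup_(i in [set: 'I_n.+1]) Rg i); split.
  - apply: measurableC; apply: fin_bigcup_measurable => // i _.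
    exact: sfs_measurable_range.
  - exact: (sfs_cover Hsfs).
  - by move=> x /=; apply: contra_not => -[i _ ix]; exists i.
apply: filterS2 dis cov => x dx [i ix]; exists i => j; split=> [jx|<-//].
by apply/eqP; apply: contrapT => /negP ij; apply: (dx i j ij).
Qed.

(** sigma is nonsingular: up to a null set, the preimage of a null set Z is covered by the finitely
    many sets sigma_i(Z n D_i), each of them null. *)
Lemma ae_coding (P : X -> Prop) :
  {ae m, forall x, P x} -> {ae m, forall x, P (sigma x)}.
Proof.
move=> [Z [mZ Z0 ZP]].
have nZ : {ae m, forall x, forall i, ~ (s i @` (Z `&` D i)) x}.
  by apply: filter_forall => i; exact: sfs_push_null.
apply: filterS3 nZ sfs_rangeK sfs_range_partition => x nx rx [i /(_ i)[_ /(_ erefl)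
  ix]].
have [Dx sx] := rx _ ix; apply: contrapT => nP.
by apply: (nx i); exists (sigma x) => //; split => //; exact: ZP.
Qed.

(** Counterpart of [ae_coding] for the branches; here the domination m o sigma_i^{-1} << m of a
    monic system is what pulls null sets back. *)
Lemma ae_branch (i : 'I_n.+1) (P : X -> Prop) : sfs_pull m D s i `<< m ->
  {ae m, forall x, P x} -> {ae m, forall x, D i x -> P (s i x)}.
Proof.
move=> dom [Z [mZ Z0 ZP]].
exists (D i `&` s i @^-1` (Z `&` Rg i)); split.
- apply: (@sfs_measurable_fun _ _ _ _ _ _ _ _ Hsfs i) => //.
    exact: sfs_measurable_dom Hsfs i.
  by apply: measurableI => //; exact: sfs_measurable_range.
- exact: ((null_content_dominatesP _ _).1 dom Z).
- move=> x /= /not_implyP[Dx nP]; split => //; split; first exact: ZP.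
  by exists x.
Qed.

(* The junk value is 0 off the union of the ranges. *)
Definition letter (x : X) : 'I_n.+1 := odflt ord0 [pick i | `[< Rg i x >]].

Definition itinerary (x : X) : nat -> 'I_n.+1 := fun k => letter (iter k sigma x).

Lemma letter_range : {ae m, forall x, forall i, Rg i x <-> letter x = i}.
Proof.
apply: filterS sfs_range_partition => x [i ix] j; rewrite ix /letter.
case: pickP => [k /asboolP /ix ->//|/(_ i) /asboolP].
by move=> /(_ ((ix i).2 erefl)).
Qed.

Lemma itinerary_coding x k : itinerary (sigma x) k = itinerary x k.+1.
Proof. by rewrite /itinerary iterSr. Qed.

Lemma mkseq_itinerary x N :
  mkseq (itinerary x) N.+1 = letter x :: mkseq (itinerary (sigma x)) N.
Proof.
rewrite /mkseq /= -[1%N]/(1 + 0)%N iotaDl -map_comp; congr (_ :: _).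
by apply: eq_map => k /=; rewrite itinerary_coding.
Qed.

Lemma letter_measurable i : measurable [set x | letter x = i].
Proof.
(* Ranges may overlap on null sets, so {letter = i} need not equal R_i. The letter depends only on
   the set [B] of ranges containing x, and there are finitely many such patterns. *)
pose pat (B : {set 'I_n.+1}) : set X :=
  \bigcap_j [set x | Rg j x <-> j \in B].
have mpat B : measurable (pat B).
  apply: fin_bigcap_measurable => // j _.
  have [jB|jB] := boolP (j \in B).
    rewrite (_ : [set _ | _] = Rg j); first exact: sfs_measurable_range.
    by apply/seteqP; split => x; [move=> /= [_]; exact|move=> /= ?; split].
  rewrite (_ : [set _ | _] = ~` Rg j).
    by apply: measurableC; exact: sfs_measurable_range.
  by apply/seteqP; split => x /=; [move=> [h _] /h|move=> h; split => // /h].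
rewrite (_ : [set _ | _] = \bigcup_(B in [set B : {set 'I_n.+1} | odflt ord0 [pick
  j in B] = i]) pat B).
  by apply: fin_bigcup_measurable => // B _; exact: mpat.
apply/seteqP; split => [x /= <-|x [B /= <- Bx]].
  exists [set j | `[< Rg j x >]]%SET.
    by rewrite /letter /=; congr odflt; apply: eq_pick => j; rewrite inE.
  by move=> j _ /=; rewrite inE; split => /asboolP.
rewrite /letter; congr odflt; apply: eq_pick => j.
by apply/asboolP/idP => /(Bx j Logic.I).
Qed.

Lemma iter_coding_measurable k : measurable_fun setT (iter k sigma).
Proof.
elim: k => [|k IH]; first exact: measurable_id.
exact: measurableT_comp (sfs_measurable_coding Hsfs) IH.
Qed.

Lemma itinerary_measurable k i : measurable [set x | itinerary x k = i].
Proof.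
rewrite -[X in measurable X]setTI.
exact: (iter_coding_measurable k measurableT (letter_measurable i)).
Qed.

End SemibranchingSystem.

(** * Word projections as multiplication operators *)

Section MonicSystem.
Context d (X : measurableType d) (R : realType) (m : probability X R).
Context (n : nat) (D : 'I_n.+1 -> set X) (s : 'I_n.+1 -> X -> X) (sigma : X -> X).
Variable f : 'I_n.+1 -> L2 m.
Hypothesis Hf : is_monic_system D s sigma f.
Local Notation Rg := (sfs_range D s).
Let Hsfs : is_sfs m D s sigma. Proof. by case: Hf. Qed.

(** Off R_i the pulled-back measure has mass m of the empty set, so its density |f_i|^2 has zero
    integral there. *)
Lemma monic_system_eq0 i : {ae m, forall x, ~ Rg i x -> f i x = 0}.
Proof.
have [_ _ RN _] := Hf; have [mf f0 fE] := RN i.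
have mR : measurable (~` Rg i).
  by apply: measurableC; exact: (sfs_measurable_range Hsfs).
have := fE _ mR; rewrite /sfs_pull setICl preimage_set0 setI0 measure0.
move=> /esym I0.
have := (ae_eq_integral_abs m mR (measurable_funTS mf)).1.
rewrite (_ : (\int[m]_(x in _) _)%E = 0%E); last first.
  by rewrite -[RHS]I0; apply: eq_integral => x _; rewrite gee0_abs.
move=> /(_ erefl); apply: filterS => x /= h Rx; have := h Rx.
by rewrite normc_sqr => -[] /sqmod_eq0.
Qed.

Context (A : 'M[nat]_n.+1) (O : cstarAlgebra R) (S : 'I_n.+1 -> O).
Hypothesis HCK : cuntz_krieger_family A S.
Variable pi : O -> L2space m -> L2space m.
Hypothesis Hpi : representation_of_monic_system S sigma f pi.

(* S_j S_j^* u is supported on the range R_j and these functions add up to u,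
   so that S_i S_i^* is multiplication by the indicator of R_i. *)
Lemma range_projection i (u : L2 m) :
  {ae m, forall x, (pi (S i * star (S i)) u : L2 m) x =
    (letter D s x == i)%:R * u x}.
Proof.
have [rep piS] := Hpi; have [_ _ pi1 piM _] := rep.
pose q j : L2 m := pi (S j * star (S j)) u.
have q0 : {ae m, forall x, forall j, ~ Rg j x -> q j x = 0}.
  apply: filter_forall => j; rewrite /q piM.
  by apply: filterS2 (piS j (pi (star (S j)) u))
    (monic_system_eq0 j) => x -> h /h ->; rewrite mul0r.
have sq : {ae m, forall x, u x = \sum_j q j x}.
  have -> : u = \sum_j q j.
    have [_ one _] := HCK.
    have := representation_sum rep (index_enum 'I_n.+1) (fun j => S j * star (S j)) u.
    by rewrite one pi1.
  by apply: L2sum_ae => j; exact: aeW.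
apply: filterS3 q0 sq (letter_range Hsfs) => x q0x sqx lx.
have [/eqP xi|xi] := boolP (letter D s x == i); last first.
  by rewrite mul0r; apply: q0x => /lx /eqP; rewrite (negbTE xi).
rewrite mul1r sqx (bigD1 i)//= big1 ?addr0// => j ji; apply: q0x => /lx.
by rewrite xi => ij; move: ji; rewrite ij eqxx.
Qed.

Lemma word_projection (I : seq 'I_n.+1) (u : L2 m) :
  {ae m, forall x, (pi (word_prod S I * star (word_prod S I)) u : L2 m) x =
    (mkseq (itinerary D s sigma x) (size I) == I)%:R * u x}.
Proof.
have [rep piS] := Hpi; have [_ _ pi1 piM _] := rep.
elim: I u => [|i I IH] u.
  by rewrite /word_prod big_nil star1 mulr1 pi1; apply: aeW => x; rewrite mul1r.
rewrite /word_prod big_cons -!/(word_prod S I) starM -mulrA [X in S i * X]mulrA !piM.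
(* Since S_{iI} S_{iI}^* = S_i (S_I S_I^* ) S_i^*, the induction hypothesis is applied to v at sigma
   x, which moves the indicator of I one letter along. No formula for v is needed: f_i . (v o sigma)
   is S_i S_i^* u, known from [range_projection]. *)
set v : L2 m := pi (star (S i)) u.
have h1 := piS i (pi (word_prod S I * star (word_prod S I)) v).
have h2 := ae_coding Hsfs (IH v).
have h3 := range_projection i u; rewrite piM in h3.
have h4 := piS i v; rewrite piM in h1; rewrite piM in h2.
apply: filterS (filterI (filterI h1 h2) (filterI h3 h4)) => x [[e1 e2] [e3 e4]].
rewrite e1 e2 mulrCA -e4 e3 mkseq_itinerary eqseq_cons mulrA.
by rewrite -natrM mulnb andbC.
Qed.

End MonicSystem.

(** * Representations of inherent monic systems *)

Section InherentMonicSystem.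
Context (R : realType) (n : nat) (A : 'M[nat]_n.+1) (HA : primitive01 A).
Local Notation XB := (markovChainBorel HA).

Lemma mc_letter (x : XB) : letter (@mc_dom n A HA) (@mc_cons n A HA) x = sval x 0%N.
Proof.
rewrite /letter; case: pickP => [i /asboolP|/(_ (sval x 0%N)) /asboolP].
  by rewrite mc_range.
by rewrite mc_range => /(_ erefl).
Qed.

(** On the chain the coding is the identity, so that the word projections there multiply by
    indicators of cylinders. *)
Lemma mc_itinerary (x : XB) :
  itinerary (@mc_dom n A HA) (@mc_cons n A HA) (@mc_shift n A HA) x = sval x.
Proof.
apply/funext => k; rewrite /itinerary mc_letter.
elim: k x => [//|k IH] x.
by rewrite iterSr IH.
Qed.

Context (mu : probability XB R) (g : 'I_n.+1 -> L2 mu).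
Hypothesis Hg : inherent_monic_system g.
Context (O : cstarAlgebra R) (S : 'I_n.+1 -> O).
Hypothesis HCK : cuntz_krieger_family A S.
Variable rho : O -> L2space mu -> L2space mu.
Hypothesis Hrho : representation_of_monic_system S (@mc_shift n A HA) g rho.

Lemma inherent_monic_representation : monic_representation S rho.
Proof.
pose one : L2 mu := toL2 mu (cindic R setT).
apply/monic_closed_span; exists one.
set P := closed_span _; have HP : closed_subspace P by exact: closed_span_subspace.
have Pcyl I : P (toL2 mu (cindic R (@mc_cylinder n A HA I))).
  rewrite (_ : toL2 _ _ = rho (word_prod S I * star (word_prod S I)) one).
    exact: (closed_span_gen (fun I => rho (word_prod S I * star (word_prod S I)) one)).
  apply/L2_eqP.
  have h1 := toL2_cindic_ae mu (mc_cylinder_measurable (HA := HA) I).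
  have h2 := toL2_cindic_ae mu measurableT.
  apply: filterS3 h1 h2 (word_projection Hg HCK Hrho I one) => x -> e ->.
  rewrite e mc_itinerary !cindicE in_setT mulr1; congr (nat_of_bool _)%:R.
  by apply/idP/eqP; rewrite inE.
apply: closed_subspace_full => //.
apply: (closed_subspace_measurable HP (mc_measurableE HA) (@mc_cylinders_setI _ _ HA)).
- move=> _ [->|[I ->]]; last exact: Pcyl.
  have [P0 _ _] := HP; rewrite (_ : toL2 _ _ = 0)//.
  apply/L2_eqP; apply: filterS2 (toL2_cindic_ae mu measurable0)
    (L2zero_ae mu) => x -> ->.
  by rewrite cindicE in_set0.
- by rewrite -(mc_cylinder_nil HA).
Qed.

End InherentMonicSystem.

(** * Factorization through a generating map *)

Section AlmostEverywhereLimit.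
Context d (X : measurableType d) (R : realType) (m : {measure set X -> \bar R}).

(** The series of the u_k has finite integral, so it converges almost everywhere and its terms tend
    to 0. *)
Lemma ae_cvg0_summable (u : nat -> X -> R) :
  (forall k, measurable_fun setT (u k)) -> (forall k x, 0 <= u k x) ->
  (forall k, (\int[m]_x (u k x)%:E <= (1 / (2 ^ k.+1)%:R)%:E)%E) ->
  {ae m, forall x, u k x @[k --> \oo] --> 0}.
Proof.
move=> mu u0 ule.
have mE k : measurable_fun setT (fun x => (u k x)%:E) by exact/measurable_EFinP.
have E0 k x : (0 <= (u k x)%:E)%E by rewrite lee_fin.
pose U x := (\sum_(0 <= k <oo) (u k x)%:E)%E.
have U0 x : (0 <= U x)%E by exact: nneseries_ge0.
have iU : m.-integrable setT U.
  apply/integrableP; split.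
    by apply: (@ge0_emeasurable_sum _ _ _ _ _ xpredT).
  under eq_integral do rewrite gee0_abs//.
  rewrite integral_nneseries//.
  (* The bounds 1/2^(k+1), summed from k = 0, add up to 1. *)
  apply: (@le_lt_trans _ _ 1%:E); last by rewrite ltry.
  apply: le_trans (epsilon_trick0 xpredT ler01).
  by apply: lee_nneseries => // k _ _; exact: integral_ge0.
apply: filterS (integrable_ae measurableT iU) => x /(_ Logic.I) Ux.
have Ulty : (U x < +oo)%E by rewrite -ge0_fin_numE.
have cvt := nneseries_tail_cvg Ulty (fun k _ => E0 k x).
suff : (u k x)%:E @[k --> \oo] --> 0%E by move=> /fine_cvgP[].
apply: (squeeze_cvge _ (cvg_cst 0%E) cvt); apply: nearW => k.
rewrite E0 /=; have := @nneseries_lim_ge _ (fun k => (u k x)%:E) xpredT k k.+1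
  (fun j _ _ => E0 j x).
by rewrite big_nat1.
Qed.

End AlmostEverywhereLimit.

Section RealLimit.
Context d (Y : measurableType d) (R : realType).

(* The junk value is 0 when the upper limit is infinite. *)
Definition rlim (a : nat -> Y -> R) (y : Y) : R :=
  fine (limn_esup (fun k => (a k y)%:E)).

(** An upper limit is measurable on all of [Y] whether or not the sequence converges; [rlimE]
    identifies it where it does. *)
Lemma rlim_measurable a : (forall k, measurable_fun setT (a k)) ->
  measurable_fun setT (rlim a).
Proof.
move=> ma; apply: measurableT_comp; first exact: fine_measurable.
by apply: (@measurable_fun_limn_esup _ _ _ _ (fun k y => (a k y)%:E)) => k;
  exact/measurable_EFinP.
Qed.

Lemma rlimE a y l : a k y @[k --> \oo] --> l -> rlim a y = l.
Proof.
move=> al; have al' : (a k y)%:E @[k --> \oo] --> l%:E.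
  by apply: cvg_EFin => //; exact: nearW.
rewrite /rlim is_cvg_limn_esupE; last by apply/cvg_ex; exists l%:E.
by rewrite (cvg_lim _ al').
Qed.

End RealLimit.

Lemma sqmod_cvg (R : realType) (z : nat -> R[i]) (w : R[i]) :
  sqmod (w - z k) @[k --> \oo] --> 0 ->
  complex.Re (z k) @[k --> \oo] --> complex.Re w /\
  complex.Im (z k) @[k --> \oo] --> complex.Im w.
Proof.
move=> zw.
have sq (g : R[i] -> R) : (forall a b, g (a - b) = g a - g b) ->
    (forall a, g a ^+ 2 <= sqmod a) -> g (z k) @[k --> \oo] --> g w.
  move=> gB gle; apply/cvgrPdist_lt => e e0.
  have /cvgrPdist_lt/(_ _ (exprn_gt0 2 e0)) := zw; apply: filterS => k.
  rewrite sub0r normrN ger0_norm ?sqmod_ge0// -gB => lte.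
  rewrite -(@ltr_pXn2r _ 2)// ?nnegrE ?(ltW e0)// -normrX ger0_norm ?sqr_ge0//.
  exact: le_lt_trans (gle _) lte.
split; apply: sq => [a b|a].
- by rewrite raddfB.
- exact: Re_sqr_le_sqmod.
- by rewrite raddfB.
- exact: Im_sqr_le_sqmod.
Qed.

Section Factorization.
Context dX dY (X : measurableType dX) (Y : measurableType dY) (R : realType).
Context (m : probability X R) (F : {mfun X >-> Y}).
Context (W : Type) (E : W -> set Y) (xi : L2 m) (b : W -> L2space m).
Hypothesis mE : forall w, measurable (E w).
Hypothesis bE : forall w, {ae m, forall x, (b w : L2 m) x = cindic R (E w)
  (F x) * xi x}.
Hypothesis b_dense : forall v, closed_span b v.

(* Approximating within 2^-k makes the squared errors summable, so that they tend
   to 0 almost everywhere. *)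
Lemma cyclic_approximation (v : L2 m) : exists phi : nat -> Y -> R[i],
  (forall k, cmeasurable (phi k)) /\
  {ae m, forall x, sqmod (v x - phi k (F x) * xi x) @[k --> \oo] --> 0}.
Proof.
have /choice[t tv] : forall k : nat, exists t : seq (R[i] * W),
    sqnorm ((v : L2space m) - \sum_(p <- t) p.1 *: b p.2) < 1 / (2 ^ k.+1)%:R.
  by move=> k; apply: b_dense; rewrite divr_gt0// ltr0n expn_gt0.
pose phi k y := \sum_(p <- t k) p.1 * cindic R (E p.2) y.
have mphi k : cmeasurable (phi k).
  apply: cmeasurable_sum => p; apply: cmeasurableM; first exact: cmeasurable_cst.
  exact: cmeasurable_cindic.
have mD k : cmeasurable (fun x => v x - phi k (F x) * xi x).
  apply: cmeasurableD; first exact: L2_cmeasurable.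
  apply: cmeasurableN; apply: cmeasurableM; last exact: L2_cmeasurable.
  exact: (@cmeasurable_comp _ _ _ _ _ F).
exists phi; split => //; apply: ae_cvg0_summable => [k|k x|k].
- exact: cmeasurable_sqmod.
- exact: sqmod_ge0.
- rewrite -(@sqnorm_L2_ae _ _ _ m ((v : L2space m) - \sum_(p <- t k) p.1 *: b p.2))//.
    by rewrite lee_fin ltW.
  have h1 := L2sub_ae v (\sum_(p <- t k) p.1 *: b p.2).
  have h2 : {ae m, forall x, (\sum_(p <- t k) p.1 *: b p.2 : L2 m) x =
      \sum_(p <- t k) p.1 * (cindic R (E p.2) (F x) * xi x)}.
    apply: (@L2sum_ae _ _ _ _ _ _ (fun p => p.1 *: b p.2)) => p.
    by apply: filterS2 (L2scale_ae p.1 (b p.2)) (bE p.2) => x -> ->.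
  apply: filterS2 h1 h2 => x -> ->; congr (_ - _).
  by rewrite /phi mulr_suml; apply: eq_bigr => p _; rewrite mulrA.
Qed.

(** Dividing the errors by |xi|^2 gives convergence of phi_k(F x) to v x / xi x. The limit is formed
    on [Y], which is what makes it a function of F x; its values where the phi_k diverge do not
    matter. *)
Lemma cyclic_quotient (v : L2 m) : exists h : Y -> R[i], cmeasurable h /\
  {ae m, forall x, xi x != 0 -> v x / xi x = h (F x)}.
Proof.
have [phi [mphi phiv]] := cyclic_approximation v.
exists (fun y => (rlim (fun k y => complex.Re (phi k y)) y +i*
  rlim (fun k y => complex.Im (phi k y)) y)%C); split.
  by split; apply: rlim_measurable => k; case: (mphi k).
apply: filterS phiv => x cx xi0.
have [|cr ci] := @sqmod_cvg _ (fun k => phi k (F x)) (v x / xi x).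
  have -> : (fun k => sqmod (v x / xi x - phi k (F x))) =
      (fun k => sqmod (v x - phi k (F x) * xi x) * sqmod (xi x)^-1).
    by apply/funext => k; rewrite -sqmodM mulrBl mulfK.
  by rewrite -[X in _ --> X](mul0r (sqmod (xi x)^-1)); apply: cvgMl.
apply/eqP; rewrite eq_complex /=; apply/andP; split; apply/eqP/esym.
- exact: (@rlimE _ _ _ (fun k y => complex.Re (phi k y))).
- exact: (@rlimE _ _ _ (fun k y => complex.Im (phi k y))).
Qed.

(** Approximate the constant 1: where xi vanishes every approximant is 0, so the squared error is
    constantly 1 and cannot tend to 0. *)
Lemma cyclic_neq0 : {ae m, forall x, xi x != 0}.
Proof.
have [phi [mphi phiv]] := cyclic_approximation (toL2 m (cindic R setT)).
apply: filterS2 phiv (toL2_cindic_ae m measurableT) => x + e.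
rewrite e cindicE in_setT => cx; apply/eqP => xi0; move: cx.
rewrite xi0; under eq_fun do rewrite mulr0 subr0.
have -> : sqmod (1 : R[i]) = 1 by rewrite /sqmod /= expr1n expr0n addr0.
move=> /(cvg_lim (@Rhausdorff R)); rewrite lim_cst// => /eqP.
by rewrite oner_eq0.
Qed.

Lemma cyclic_factorization (v : L2 m) : exists h : Y -> R[i], cmeasurable h /\
  {ae m, forall x, v x = h (F x)}.
Proof.
have [h [mh hv]] := cyclic_quotient v.
have [h1 [mh1 hv1]] := cyclic_quotient (toL2 m (cindic R setT)).
exists (fun y => h y * (h1 y)^-1); split.
  by apply: cmeasurableM => //; exact: cmeasurableV.
apply: filterS (filterI (filterI hv hv1) (filterI cyclic_neq0
  (toL2_cindic_ae m measurableT))).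
move=> x [[e e1] [xi0 i1]]; rewrite -e// -e1// i1 cindicE in_setT mul1r invrK.
by rewrite mulfVK.
Qed.

End Factorization.

(** * Pullback along a measurable map *)

(** The transported representation is V^{-1} pi V. The inverse comes from choice, and identities in
    [K] are checked after applying [V], injective because it is isometric. *)
Lemma unitary_transport (R : realType) (O : cstarAlgebra R)
    (H K : innerProductSpace R) (pi : O -> H -> H) (V : K -> H) :
  is_representation pi -> linear V ->
  (forall v w, inner (V v) (V w) = inner v w) -> (forall u, exists w, V w = u) ->
  exists rho : O -> K -> K, [/\ is_representation rho, unitarily_equivalent pi rho
    & forall a w, V (rho a w) = pi a (V w)].
Proof.
move=> [pibd pilin pi1 piM pistar] linV isoV surV.
have linV' c u v : V (c *: u + v) = c *: V u + V v := linV c u v.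
have sqV w : sqnorm (V w) = sqnorm w by rewrite /sqnorm isoV.
have injV : injective V.
  move=> v w vw; apply/eqP; rewrite -subr_eq0; apply/eqP/inner_eq0.
  have e : V (v - w) = 0.
    by rewrite addrC -scaleN1r linV' vw scaleN1r addNr.
  by rewrite -isoV e inner0l.
have [U VU] := choice surV.
exists (fun a w => U (pi a (V w))); split => //; last first.
  exists U; split.
  - by move=> c u v; apply: injV; rewrite linV' !VU.
  - by move=> u v; rewrite -isoV !VU.
  - by move=> w; exists (V w); apply: injV; rewrite VU.
  - by move=> a u; rewrite VU.
split.
- move=> a; have [lina [M HM]] := pibd a; split.
    by move=> c u v; apply: injV; rewrite !linV' !VU lina.
    by exists M => w; have := HM (V w); rewrite /ipnorm -!isoV !VU.
- by move=> c a a' w; apply: injV; rewrite linV' !VU pilin.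
- by move=> w; apply: injV; rewrite VU pi1.
- by move=> a a' w; apply: injV; rewrite !VU piM.
- by move=> a v w; rewrite -!isoV !VU pistar.
Qed.

Lemma integrable_ae_eq d (T : measurableType d) (R : realType)
    (mu : {measure set T -> \bar R}) (f g : T -> \bar R) :
  measurable_fun setT g -> mu.-integrable setT f ->
  {ae mu, forall x, f x = g x} -> mu.-integrable setT g.
Proof.
move=> mg /integrableP[mf If] fg; apply/integrableP; split => //.
suff <- : (\int[mu]_x `|f x| = \int[mu]_x `|g x|)%E by [].
apply: ae_eq_integral => //; try exact: measurableT_comp.
by apply: filterS fg => x ->.
Qed.

Section Pullback.
Context dX dY (X : measurableType dX) (Y : measurableType dY) (R : realType).
Context (m : probability X R) (F : {mfun X >-> Y}).
Local Notation mu := (distribution m F).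

Lemma ae_distribution (P : Y -> Prop) :
  {ae mu, forall y, P y} -> {ae m, forall x, P (F x)}.
Proof.
move=> [Z [mZ Z0 ZP]]; exists (F @^-1` Z); split => //.
- exact: measurable_funPTI.
- by move=> x /= nP; exact: ZP.
Qed.

(** Unlike in [ae_distribution], measurability of [P] is required: a null set of [X] is controlled
    in [Y] only when it is the preimage of a measurable set. *)
Lemma ae_distribution_measurable (P : Y -> Prop) : measurable [set y | P y] ->
  {ae m, forall x, P (F x)} -> {ae mu, forall y, P y}.
Proof.
move=> mP HP; apply/(negligibleP _ (measurableC mP)).
have mFP : measurable (F @^-1` (~` [set y | P y])).
  by apply: measurable_funPTI => //; exact: measurableC.
exact: (negligibleP _ mFP).1.
Qed.

Lemma cmeasurable_mfun (h : Y -> R[i]) : cmeasurable h -> cmeasurable (h \o F).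
Proof. exact: cmeasurable_comp. Qed.

Lemma integral_sqmod_distribution (h : Y -> R[i]) : cmeasurable h ->
  (\int[mu]_y (sqmod (h y))%:E = \int[m]_x (sqmod (h (F x)))%:E)%E.
Proof.
move=> mh; rewrite ge0_integral_distribution//.
- by apply/measurable_EFinP; exact: cmeasurable_sqmod.
- by move=> y; rewrite lee_fin sqmod_ge0.
Qed.

Lemma CLfun2_distribution (h : Y -> R[i]) : cmeasurable h ->
  h \in CLfun2 mu <-> h \o F \in CLfun2 m.
Proof.
move=> mh; split=> /CLfun2P[_ lh]; apply/CLfun2P; split => //.
- exact: cmeasurable_mfun.
- by rewrite -integral_sqmod_distribution.
- by rewrite integral_sqmod_distribution.
Qed.

Lemma ae_distribution_eq (h k : Y -> R[i]) : cmeasurable h -> cmeasurable k ->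
  {ae m, forall x, h (F x) = k (F x)} -> {ae mu, forall y, h y = k y}.
Proof.
move=> mh mk; apply: ae_distribution_measurable.
rewrite (_ : [set _ | _] = [set y | h y + - k y = 0]).
  by apply: cmeasurable_eq; apply: cmeasurableD => //; exact: cmeasurableN.
by apply/seteqP; split => y /=; [move=> ->; rewrite subrr|move=> /subr0_eq].
Qed.

Lemma integral_sqmod_distribution_set (h : Y -> R[i]) (C : set Y) :
  cmeasurable h -> measurable C ->
  (\int[mu]_(y in C) (sqmod (h y))%:E = \int[m]_(x in F @^-1` C) (sqmod (h
    (F x)))%:E)%E.
Proof.
move=> mh mC; rewrite ge0_integral_pushforward//.
- by apply/measurable_funTS/measurable_EFinP; exact: cmeasurable_sqmod.
- by move=> y _; rewrite lee_fin sqmod_ge0.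
Qed.

Definition pullback (h : L2 mu) : L2 m := toL2 m (h \o F).

Lemma pullback_ae (h : L2 mu) : {ae m, forall x, pullback h x = h (F x)}.
Proof.
apply: toL2_ae; apply/(CLfun2_distribution (L2_cmeasurable h)); exact: L2_CLfun2.
Qed.

Lemma pullback_linear : linear (pullback : L2space mu -> L2space m).
Proof.
move=> c u v; apply/L2_eqP.
have h1 := pullback_ae (c *: u + v).
have h2 := ae_distribution (L2add_ae (c *: (u : L2 mu)) v).
have h3 := ae_distribution (L2scale_ae c u).
have h4 := L2add_ae (c *: pullback u) (pullback v).
have h5 := L2scale_ae c (pullback u).
apply: filterS (filterI (filterI h1 (filterI h2 h3)) (filterI (filterI h4 h5)
  (filterI (pullback_ae u) (pullback_ae v)))).
by move=> x [[-> [-> ->]] [[-> ->] [-> ->]]].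
Qed.

Lemma pullback_inner (u v : L2space mu) :
  inner (pullback u : L2space m) (pullback v) = inner u v.
Proof.
rewrite /= /L2inner.
have I1 := Cintegrable_ip (pullback u) (pullback v).
have ae1 : {ae m, forall x, pullback u x * conjc (pullback v x) =
    (u : L2 mu) (F x) * conjc ((v : L2 mu) (F x))}.
  by apply: filterS2 (pullback_ae u) (pullback_ae v) => x -> ->.
have mc (w : Y -> R[i]) : cmeasurable w -> cmeasurable (fun y => conjc (w y)).
  move=> [wr wi]; split => /=.
    by rewrite (_ : (fun _ => _) = (fun y => complex.Re (w y)))//;
      apply/funext => y; case: (w y).
  rewrite (_ : (fun _ => _) = (fun y => - complex.Im (w y))).
    exact: measurableT_comp.
  by apply/funext => y; case: (w y).
have muv : cmeasurable (fun y => (u : L2 mu) y * conjc ((v : L2 mu) y)).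
  by apply: cmeasurableM; [exact: L2_cmeasurable|apply: mc; exact: L2_cmeasurable].
(* The change of variables needs the composite itself to be integrable; this is inherited from the
   product of the pullbacks, to which it is equal almost everywhere. *)
have I3 : Cintegrable m (fun x => (u : L2 mu) (F x) * conjc ((v : L2 mu) (F x))).
  have [mr mi] := cmeasurable_mfun muv; have [ir ii] := I1.
  split.
  - apply: (integrable_ae_eq _ ir); first exact/measurable_EFinP.
    by apply: filterS ae1 => x /= ->.
  - apply: (integrable_ae_eq _ ii); first exact/measurable_EFinP.
    by apply: filterS ae1 => x /= ->.
rewrite (Cintegral_ae I1 I3 ae1) /Cintegral /Rintegral.
have [ir ii] := I3; have [mr mi] := muv.
congr (fine _ +i* fine _)%C; rewrite integral_distribution//; exact/measurable_EFinP.
Qed.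

Hypothesis factor : forall v : L2 m, exists h : Y -> R[i],
  cmeasurable h /\ {ae m, forall x, v x = h (F x)}.

Lemma pullback_surj (v : L2 m) : exists h : L2 mu, pullback h = v.
Proof.
have [h [mh vh]] := factor v.
have Lh : h \in CLfun2 mu.
  apply/CLfun2P; split => //; rewrite integral_sqmod_distribution//.
  rewrite -(@ae_eq_integral_sqmod _ _ _ m v)//.
  - by have /CLfun2P[] := L2_CLfun2 v.
  - exact: L2_cmeasurable.
  - exact: cmeasurable_mfun.
exists (toL2 mu h); apply/L2_eqP.
apply: filterS3 (pullback_ae (toL2 mu h)) (ae_distribution (toL2_ae Lh)) vh.
by move=> x -> -> ->.
Qed.

End Pullback.

(** * The coding map *)

Lemma ae_eq_measure d (T : measurableType d) (R : realType)
    (mu : {measure set T -> \bar R}) (B C : set T) :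
  measurable B -> measurable C -> {ae mu, forall x, B x <-> C x} -> mu B = mu C.
Proof.
move=> mB mC BC; rewrite -[B]setIT -[C]setIT -!integral_indic//.
apply: ae_eq_integral => //; try by apply/measurable_EFinP; exact: measurable_indic.
apply: filterS BC => x /= BCx _; congr EFin; rewrite !indicE; congr (nat_of_bool _)%:R.
by apply/idP/idP; rewrite !inE => /BCx.
Qed.

Section Coding.
Context d (X : measurableType d) (R : realType) (m : probability X R).
Context (n : nat) (A : 'M[nat]_n.+1) (HA : primitive01 A).
Context (D : 'I_n.+1 -> set X) (s : 'I_n.+1 -> X -> X) (sigma : X -> X).
Hypothesis Hsfs : is_sfs m D s sigma.
Hypothesis HCK : sfs_cuntz_krieger m A D s.
Local Notation Rg := (sfs_range D s).
Local Notation XB := (markovChainBorel HA).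
Local Notation itin := (itinerary D s sigma).

Lemma letter_dom : {ae m, forall x, forall i, D i x <-> A i (letter D s x) = 1%N}.
Proof.
have h : {ae m, forall x, forall i,
    D i x <-> (\bigcup_(j in [set j | A i j = 1%N]) Rg j) x}.
  by apply: filter_forall => i; exact: HCK.
apply: filterS2 h (letter_range Hsfs) => x hx lx i; rewrite hx; split.
  by move=> [j ij /lx ->].
by move=> il; exists (letter D s x) => //; exact/lx.
Qed.

(** If i is the letter of x, then sigma x lies in D_i, and (C-K) read at sigma x says that a_{i,j} =
    1 for its letter j. Nonsingularity of sigma propagates this along the orbit. *)
Lemma itinerary_admissible : {ae m, forall x, admissible A (itin x)}.
Proof.
apply: ae_foralln => k.
have h0 : {ae m, forall x, A (letter D s x) (letter D s (sigma x)) = 1%N}.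
  apply: filterS3 (sfs_rangeK Hsfs) (letter_range Hsfs) (ae_coding Hsfs letter_dom).
  by move=> x rx lx dx; apply/dx; case: (rx (letter D s x)) => //; exact/lx.
elim: k => [//|k IH].
apply: filterS (ae_coding Hsfs IH) => x.
by rewrite !itinerary_coding.
Qed.

(** The points of the null set with inadmissible itinerary are sent to the base point, which makes
    the map total and measurable. *)
Definition coding_map (x : X) : XB :=
  match pselect (admissible A (itin x)) with
  | left h => exist _ _ h
  | right _ => point
  end.

Lemma coding_mapE x : admissible A (itin x) -> sval (coding_map x) = itin x.
Proof. by rewrite /coding_map; case: pselect. Qed.

Lemma admissible_measurable : measurable [set x | admissible A (itin x)].
Proof.
rewrite (_ : [set _ | _] = \bigcap_k \bigcup_(p in [set p : 'I_n.+1 * 'I_n.+1 | A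
  p.1 p.2 = 1%N])
    ([set x | itin x k = p.1] `&` [set x | itin x k.+1 = p.2])).
  apply: bigcapT_measurable => k; apply: fin_bigcup_measurable => // p _.
  by apply: measurableI; exact: (itinerary_measurable Hsfs).
apply/seteqP; split => [x ax k _|x ax k].
  by exists (itin x k, itin x k.+1) => //; exact: ax.
by have [[i j] /= ij [-> ->]] := ax k Logic.I.
Qed.

Lemma coding_map_measurable : measurable_fun setT coding_map.
Proof.
apply: mc_measurable_fun => k i; rewrite setTI.
rewrite (_ : [set _ | _] = ([set x | admissible A (itin x)] `&` [set x | itin x k = i])
  `|` (~` [set x | admissible A (itin x)] `&` [set x | sval (point : XB) k = i])).
  apply: measurableU; apply: measurableI.
  - exact: admissible_measurable.
  - exact: (itinerary_measurable Hsfs).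
  - by apply: measurableC; exact: admissible_measurable.
  - have [e|e] := pselect (sval (point : XB) k = i).
      by rewrite (_ : [set _ | _] = setT)//; apply/seteqP; split => // x _ /=.
    by rewrite (_ : [set _ | _] = set0)//; apply/seteqP; split => x //= /e.
apply/seteqP; split => x /=; rewrite /coding_map; case: pselect => h /=.
- by left.
- by right.
- by case=> [[]|[]].
- by case=> [[]|[]].
Qed.

Definition coding_mfun : {mfun X >-> XB} :=
  HB.pack coding_map (isMeasurableFun.Build _ _ _ _ _ coding_map_measurable).
Local Notation F := coding_mfun.

Lemma coding_ae : {ae m, forall x, sval (F x) = itin x}.
Proof. by apply: filterS itinerary_admissible => x /coding_mapE. Qed.

Lemma coding_shift : {ae m, forall x, F (sigma x) = mc_shift (F x)}.
Proof.
apply: filterS2 coding_ae (ae_coding Hsfs coding_ae) => x e1 e2.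
apply: mc_eqP => k; rewrite e2 itinerary_coding.
by rewrite -[RHS]/(sval (F x) k.+1) e1.
Qed.

Lemma coding_letter : {ae m, forall x, sval (F x) 0%N = letter D s x}.
Proof. by apply: filterS coding_ae => x ->. Qed.

Lemma coding_dom : {ae m, forall x, forall i, mc_dom i (F x) <-> D i x}.
Proof.
by apply: filterS2 coding_letter letter_dom => x e dx i; rewrite dx -e.
Qed.

Lemma coding_range : {ae m, forall x, forall i, Rg i x <-> sval (F x) 0%N = i}.
Proof.
by apply: filterS2 coding_letter (letter_range Hsfs) => x -> rx i.
Qed.

(** A point of the chain is determined by its first letter and its shift. For F(sigma_i x) these are
    i and F(sigma(sigma_i x)) = F x. *)
Lemma coding_branch i : sfs_pull m D s i `<< m ->
  {ae m, forall x, D i x -> F (s i x) = mc_cons i (F x)}.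
Proof.
move=> dom.
have h1 := ae_branch Hsfs dom coding_range.
have h2 := ae_branch Hsfs dom coding_shift.
apply: filterS3 h1 h2 (sfs_coding Hsfs i) => x rx sx cx Dx.
rewrite -(mc_cons_shift (F (s i x))) -sx// cx//; congr mc_cons.
by apply/(rx Dx); exists x.
Qed.

Local Notation mu := (distribution m F).

(** The sets F^{-1}(sigma_i(C n D_i)), with the branch of the chain, and sigma_i(F^{-1}(C) n D_i),
    with that of [X], differ only by a null set, as F intertwines the coding maps and respects
    ranges. *)
Lemma sfs_push_distribution i (C : set XB) : measurable C ->
  sfs_push mu (@mc_dom n A HA) (@mc_cons n A HA) i C = sfs_push m D s i (F @^-1` C).
Proof.
move=> mC; rewrite /sfs_push mc_image_cons; last by move=> x [].
have mCi : measurable (C `&` mc_dom i).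
  by apply: measurableI => //; exact: mc_dom_measurable.
apply: (@ae_eq_measure _ _ _ m (F @^-1` _)).
- apply: measurable_funPTI => //; apply: measurableI.
    exact: mc_coord_measurable.
  by have := mc_shift_measurable measurableT mCi; rewrite setTI.
- apply: (sfs_measurable_image Hsfs); last by move=> x [].
  apply: measurableI; first exact: measurable_funPTI.
  exact: (sfs_measurable_dom Hsfs i).
- apply: filterS3 (sfs_rangeK Hsfs) coding_shift coding_range => x rx sx cx.
  split=> [[/cx ix []]|[y [Cy Dy] yx]].
    rewrite -sx => CFx _; have [Dx xs] := rx _ ix.
    by exists (sigma x).
  have ix : Rg i x by exists y.
  have [Dx xs] := rx _ ix; have xy : sigma x = y.
    by apply: (sfs_inj Hsfs (i := i)); rewrite ?inE// xs.
  have ix' : sval (F x) 0%N = i by exact/cx.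
  split => //; split; first by rewrite -sx xy.
  by rewrite -ix'; exact: mc_dom_shift.
Qed.

Lemma sfs_pull_distribution i (C : set XB) : measurable C -> sfs_pull m D s i `<< m ->
  sfs_pull mu (@mc_dom n A HA) (@mc_cons n A HA) i C = sfs_pull m D s i (F @^-1` C).
Proof.
move=> mC dom; rewrite /sfs_pull; apply: (@ae_eq_measure _ _ _ m (F @^-1` _)).
- apply: measurable_funPTI => //.
  have mCR : measurable (C `&` sfs_range (@mc_dom n A HA) (@mc_cons n A HA) i).
    by apply: measurableI => //; rewrite mc_range; exact: mc_coord_measurable.
  by have := mc_cons_measurable (mc_dom_measurable i) mCR.
- apply: (@sfs_measurable_fun _ _ _ _ _ _ _ _ Hsfs i).
    exact: sfs_measurable_dom Hsfs i.
  apply: measurableI; first exact: measurable_funPTI.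
  exact: (sfs_measurable_range Hsfs).
- apply: filterS2 coding_dom (coding_branch dom) => x dx bx; split.
    move=> [/dx Dx [CFx _]]; split => //; split; last by exists x.
    by apply: (@eq_ind_r _ _ C CFx); exact: bx.
  move=> [Dx [CFx _]]; split; first exact/dx.
  split; first by apply: (@eq_ind _ _ C CFx); exact: bx.
  by exists (F x) => //; exact/dx.
Qed.

End Coding.

(** * Transport to the Markov chain *)

Section TransportedSystem.
Context d (X : measurableType d) (R : realType) (m : probability X R).
Context (n : nat) (A : 'M[nat]_n.+1) (HA : primitive01 A).
Context (D : 'I_n.+1 -> set X) (s : 'I_n.+1 -> X -> X) (sigma : X -> X).
Context (f : 'I_n.+1 -> L2 m).
Hypothesis Hf : is_monic_system D s sigma f.
Hypothesis HCK : sfs_cuntz_krieger m A D s.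
Hypothesis Hsfs : is_sfs m D s sigma.
Local Notation XB := (markovChainBorel HA).
Local Notation F := (coding_mfun HA Hsfs).
Local Notation mu := (distribution m F).
Hypothesis factor : forall v : L2 m, exists h : XB -> R[i],
  cmeasurable h /\ {ae m, forall x, v x = h (F x)}.

(** A smaller piece C of F^{-1}(B) exists in [X]. Its indicator factors as h o F, so B n {h = 1} has
    preimage C up to a null set and splits B. *)
Lemma distribution_nonatomic : nonatomic mu.
Proof.
move=> B mB B0.
have mFB : measurable (F @^-1` B) by exact: measurable_funPTI.
have [C [mC CB C0 CltB]] := sfs_nonatomic Hsfs mFB B0.
have [h [mh hC]] := factor (toL2 m (cindic R C)).
have mC' : measurable (B `&` [set y | h y = 1]).
  by apply: measurableI => //; exact: cmeasurable_eq.
have e : mu (B `&` [set y | h y = 1]) = m C.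
  apply: (@ae_eq_measure _ _ _ m (F @^-1` _)) => //; first exact: measurable_funPTI.
  apply: filterS2 hC (toL2_cindic_ae m mC) => x e1 e2.
  have hx : h (F x) = (x \in C)%:R by rewrite -e1 e2 cindicE.
  split=> [[_ hx1]|Cx]; last by split; [exact: CB|rewrite /= hx mem_set].
  move: (etrans (esym hx) hx1); case: (boolP (x \in C)); rewrite ?inE// => _ /eqP.
  by rewrite eq_sym oner_eq0.
rewrite -e in C0 CltB.
by exists (B `&` [set y | h y = 1]); split.
Qed.

Lemma push_density i : exists2 k : XB -> R[i], cmeasurable k &
  is_RN_derivative mu (sfs_push mu (@mc_dom n A HA) (@mc_cons n A HA) i)
    (fun y => (sqmod (k y))%:E) /\
  {ae mu, forall y, mc_dom i y -> (0 < (sqmod (k y))%:E)%E}.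
Proof.
have [h0 [mh0 h00 h0E] h0pos] := sfs_derivative Hsfs i.
have h0i : m.-integrable setT h0.
  apply/integrableP; split => //.
  under eq_integral do rewrite gee0_abs//.
  (* The total integral of the density is m(sigma_i(D_i)), at most 1. *)
  rewrite -h0E//; apply: (@le_lt_trans _ _ 1%:E); last exact: ltry.
  apply: probability_le1; apply: (sfs_measurable_image Hsfs); last by move=> x [].
  by rewrite setTI; exact: (sfs_measurable_dom Hsfs i).
(* A density is only in L^1, whereas factorization applies to L^2: take square roots. *)
pose r x := ((fine (h0 x)) `^ 2^-1)%:C%C : R[i].
have sr x : sqmod (r x) = fine (h0 x).
  rewrite /sqmod /r /= expr0n addr0 -powR_mulrn ?powR_ge0//.
  rewrite -powRrM mulVf ?pnatr_eq0// powRr1//.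
  by rewrite fine_ge0.
have h0r : {ae m, forall x, (sqmod (r x))%:E = h0 x}.
  apply: filterS (integrable_ae measurableT h0i) => x /(_ Logic.I) h0x.
  by rewrite sr fineK.
have mr : cmeasurable r.
  split; last exact: measurable_cst.
  apply: (measurableT_comp (measurable_powR _)).
  by apply: measurableT_comp => //; exact: fine_measurable.
have intr : (\int[m]_x (sqmod (r x))%:E = \int[m]_x h0 x)%E.
  apply: ae_eq_integral => //.
    by apply/measurable_EFinP; exact: cmeasurable_sqmod.
  by apply: filterS h0r => x ->.
have Lr : r \in CLfun2 m.
  apply/CLfun2P; split => //; rewrite intr.
  by have /integrableP[_] := h0i; under eq_integral do rewrite gee0_abs//.
have [k [mk kr]] := factor (toL2 m r).
have kh : {ae m, forall x, (sqmod (k (F x)))%:E = h0 x}.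
  by apply: filterS3 kr (toL2_ae Lr) h0r => x <- ->.
exists k => //; split; first split.
- by apply/measurable_EFinP; exact: cmeasurable_sqmod.
- by move=> y; rewrite lee_fin sqmod_ge0.
- move=> C mC; have mFC : measurable (F @^-1` C) by exact: measurable_funPTI.
  rewrite sfs_push_distribution// h0E// integral_sqmod_distribution_set//.
  apply: ae_eq_integral => //.
  + exact: measurable_funTS.
  + apply/measurable_EFinP/measurable_funTS; apply: cmeasurable_sqmod.
    exact: cmeasurable_mfun.
  + by apply: filterS kh => x ->.
- apply: ae_distribution_measurable.
    (* The implication is rewritten as a union of measurable sets, as transfer to the image measure
       demands. *)
    rewrite (_ : [set _ | _] = ~` mc_dom i `|` ~` [set y | k y = 0]).
      apply: measurableU; apply: measurableC; first exact: mc_dom_measurable.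
      exact: cmeasurable_eq.
    apply/seteqP; split => y /=; rewrite lte_fin.
      have [iy /(_ iy) ky|niy _] := pselect (mc_dom i y); [right|by left].
      by move=> k0; move: ky; rewrite k0 sqmod0 ltxx.
    move=> [//|ky _]; rewrite lt_neqAle sqmod_ge0 andbT eq_sym.
    by apply/eqP => /sqmod_eq0.
  apply: filterS3 kh h0pos (coding_dom HA Hsfs HCK) => x -> hx dx /dx.
  exact: hx.
Qed.

Lemma mc_is_sfs : is_sfs mu (@mc_dom n A HA) (@mc_cons n A HA) (@mc_shift n A HA).
Proof.
split.
- exact: distribution_nonatomic.
- exact: mc_dom_measurable.
- exact: mc_cons_measurable.
- exact: mc_cons_inj.
- move=> i C mC CD; rewrite mc_image_cons//; apply: measurableI.
    exact: mc_coord_measurable.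
  by have := mc_shift_measurable measurableT mC; rewrite setTI.
- move=> i j ij; rewrite !mc_range (_ : _ `&` _ = set0) ?measure0//.
  by apply/seteqP; split => // x [/= -> /eqP]; rewrite (negbTE ij).
- rewrite (_ : ~` _ = set0) ?measure0//; apply/seteqP; split => // x /=; apply.
  by exists (sval x 0%N) => //; rewrite mc_range.
- move=> i; apply/null_content_dominatesP => C mC C0.
  rewrite sfs_push_distribution//.
  apply: ((null_content_dominatesP _ _).1 (sfs_dominated Hsfs i)) => //.
  exact: measurable_funPTI.
- by move=> i; have [k mk [RN pos]] := push_density i;
  exists (fun y => (sqmod (k y))%:E).
- exact: mc_shift_measurable.
- by move=> i; apply: aeW => x; exact: mc_shift_cons.
Qed.

(** Since |g_i o F|^2 = |f_i|^2 almost everywhere and the pulled-back measures correspond under F, a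
    change of variables identifies the densities. *)
Lemma transported_monic_system (g : 'I_n.+1 -> L2 mu) :
  (forall i, pullback (g i) = f i) -> inherent_monic_system g.
Proof.
move=> gf; have [_ dom RN f0] := Hf; split.
- exact: mc_is_sfs.
- move=> i; apply/null_content_dominatesP => C mC C0.
  rewrite sfs_pull_distribution//.
  apply: ((null_content_dominatesP _ _).1 (dom i)) => //.
  exact: measurable_funPTI.
- move=> i; have [mf _ fE] := RN i.
  have mg := L2_cmeasurable (g i).
  split.
  + under eq_fun do rewrite normc_sqr.
    by apply/measurable_EFinP; exact: cmeasurable_sqmod.
  + by move=> y; rewrite lee_fin sqr_ge0.
  + move=> C mC; have mFC : measurable (F @^-1` C) by exact: measurable_funPTI.
    rewrite sfs_pull_distribution// fE//.
    under [RHS]eq_integral do rewrite normc_sqr.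
    rewrite integral_sqmod_distribution_set//; apply: ae_eq_integral => //.
    * exact: measurable_funTS.
    * apply/measurable_EFinP/measurable_funTS; apply: cmeasurable_sqmod.
      exact: cmeasurable_mfun.
    * by rewrite -gf; apply: filterS (pullback_ae (g i)) => x ->; rewrite normc_sqr.
- move=> i; apply: ae_distribution_measurable.
    rewrite (_ : [set _ | _] = ~` [set x : XB | sval x 0%N = i] `|` ~` [set y | g i
      y = 0]).
      apply: measurableU; apply: measurableC; first exact: mc_coord_measurable.
      by apply: cmeasurable_eq; exact: L2_cmeasurable.
    rewrite mc_range; apply/seteqP; split => y /=.
      have [iy /(_ iy)/eqP|niy _] := pselect (sval y 0%N = i); by [right|left].
    by move=> [//|/eqP].
  have h := f0 i; rewrite -gf in h.
  apply: filterS3 h (pullback_ae (g i)) (coding_range HA Hsfs HCK) => x + e cx.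
  by rewrite e mc_range => fx xi; apply: fx; exact/cx.
Qed.

Context (O : cstarAlgebra R) (S : 'I_n.+1 -> O).
Variable pi : O -> L2space m -> L2space m.
Hypothesis Hpi : representation_of_monic_system S sigma f pi.

Lemma transported_representation : exists (g : 'I_n.+1 -> L2 mu)
    (rho : O -> L2space mu -> L2space mu),
  [/\ inherent_monic_system g,
      representation_of_monic_system S (@mc_shift n A HA) g rho
    & unitarily_equivalent pi rho].
Proof.
have /choice[g gf] : forall i, exists h : L2 mu, pullback h = f i.
  by move=> i; exact: pullback_surj.
have [rep piS] := Hpi.
have [rho [rhorep Urho rhoE]] := unitary_transport rep (@pullback_linear _ _ _ _ _ m F)
  (@pullback_inner _ _ _ _ _ m F) (pullback_surj factor).
exists g, rho; split => //; first exact: transported_monic_system.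
split => // i u.
(* The formula for rho(S_i) u is checked after composition with F, where it becomes the one for
   pi(S_i) on the pullback of u, because F o sigma is the shift after F. *)
apply: ae_distribution_eq.
- exact: L2_cmeasurable.
- apply: cmeasurableM; first exact: L2_cmeasurable.
  apply: (@cmeasurable_comp _ _ _ _ _ (@mc_shift n A HA)); last exact: L2_cmeasurable.
  exact: mc_shift_measurable.
have h1 := pullback_ae (rho (S i) u : L2 mu); rewrite rhoE in h1.
have h2 := piS i (pullback u).
have h3 := ae_coding Hsfs (pullback_ae u).
have h4 := pullback_ae (g i); rewrite gf in h4.
have h5 := coding_shift HA Hsfs HCK.
apply: filterS (filterI (filterI h1 h2) (filterI h3 (filterI h4 h5))).
by move=> x [[e1 e2] [e3 [e4 e5]]]; rewrite -e1 e2 e3 e4 e5.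
Qed.

End TransportedSystem.

(** * The equivalence *)

Theorem theorem5p6 (R : realType) (n : nat) (A : 'M[nat]_n.+1)
  (HA : primitive01 A)
  (OA : cstarAlgebra R) (S : 'I_n.+1 -> OA)
  (HOA : is_cuntz_krieger_algebra A S)
  (d : measure_display) (X : measurableType d) (m : probability X R)
  (D : 'I_n.+1 -> set X) (s : 'I_n.+1 -> X -> X) (sigma : X -> X)
  (Hsfs : is_sfs m D s sigma)
  (Hsat : sfs_saturated m D)
  (HCK : sfs_cuntz_krieger m A D s)
  (f : 'I_n.+1 -> L2 m)
  (Hf : is_monic_system D s sigma f)
  (pi : OA -> L2space m -> L2space m)
  (Hpi : representation_of_monic_system S sigma f pi) :
  monic_representation S pi <->
  exists (mu : probability (markovChainBorel HA) R)
         (g : 'I_n.+1 -> L2 mu)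
         (rho : OA -> L2space mu -> L2space mu),
    [/\ inherent_monic_system g,
        representation_of_monic_system S (@mc_shift n A HA) g rho
      & unitarily_equivalent pi rho].
Proof.
have [HS _ _] := HOA; split; last first.
  move=> [mu [g [rho [Hg Hrho]]]] /monic_unitarily_equivalent; apply.
  exact: (inherent_monic_representation Hg HS Hrho).
move=> /monic_closed_span[xi xi_dense].
exists (distribution m (coding_mfun HA Hsfs)).
apply: (transported_representation Hf HCK _ Hpi).
(* The dense family is indexed by words: S_I S_I^* xi is the indicator of the cylinder of I,
   composed with F, times xi. *)
apply: (@cyclic_factorization _ _ _ _ _ _ _ _ (@mc_cylinder n A HA) xi
  (fun I => pi (word_prod S I * star (word_prod S I)) xi)) => //.
- by move=> I; exact: mc_cylinder_measurable.
- move=> I; apply: filterS2 (coding_ae HA Hsfs HCK) (word_projection Hf HS Hpi I xi).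
  move=> x e ->; rewrite -e cindicE; congr ((nat_of_bool _)%:R * _).
  by apply/eqP/idP; rewrite inE.
Qed.
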